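(* Let $n\ge 2$ and let $J,K\subseteq S_n^D=\{t,s_1,\ldots,s_{n-1}\}$, where $J$ does not satisfy both $s_1\notin J$ and $t\in J$. Let $\lambda=(\lambda_1,\ldots,\lambda_p)$ be the signed composition of $n$ corresponding to $J$, and let $\eta_\lambda$ (respectively $\epsilon_\lambda$) be the character of the representation of $H_n^D$ induced from the trivial (respectively sign) representation of the parabolic subalgebra $H_J$. Let $w$ be a parabolic element of type $K$. Then $$\eta_\lambda(T_w)=\sum_a q^{e_K(a)+g_K(a)}(q-1)^{d_K(a)+f_K(a)}, \qquad \epsilon_\lambda(T_w)=\sum_a (-1)^{e_K(a)+g_K(a)}(q-1)^{d_K(a)+f_K(a)},$$ where both sums are over all integer sequences $a=a_1\cdots a_n$ such that (1) $1\le|a_i|\le p$ for all $i$; (2) $\#\{i:|a_i|=k\}=|\lambda_k|$ for $k=1,\ldots,p$; (3) $\#\{i : a_i<0\}$ is even; (4) if $t\in J$, then $a_i\neq -1$ for at most one $i$, and for such $i$ we have $a_j\ne 1$ for all $j<i$; (5) if $s_i\in K$, then either $a_i\ge a_{i+1}$, or $t\in J$, $a_i=-1$, $a_{i+1}=1$; (6) if $t\in K$, then: $|a_1|>|a_2|\Rightarrow a_1<0$; $|a_1|<|a_2|\Rightarrow a_2<0$; $|a_1|=|a_2|\Rightarrow$ ($a_2<0$, or $a_1=a_2=1$ and $t\in J$); and where $d_K(a)=\#\{i: s_i\in K,\ a_i>a_{i+1}\}$, $e_K(a)=\#\{i : s_i\in K,\ a_i\le a_{i+1}\}$, $f_K(a)=1$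 if $t\in K$ and ($a_1=a_2<0$ or $|a_1|\ne|a_2|$) and $f_K(a)=0$ otherwise, and $g_K(a)=1$ if $t\in K$ and ($a_1=-a_2$ or $a_1=a_2=1$) and $g_K(a)=0$ otherwise.
   Context: The Coxeter group $D_n$ is realized as the group of signed permutations $w$ of $\{\pm1,\ldots,\pm n\}$ (i.e. $w(-i)=-w(i)$) such that $\#\{i>0: w(i)<0\}$ is even. It is generated by $t$, which sends $1\mapsto -2$, $2\mapsto -1$, $-1\mapsto 2$, $-2\mapsto 1$ and fixes all other elements, and $s_i$ ($1\le i\le n-1$), which swaps $i\leftrightarrow i+1$ and $-i\leftrightarrow -(i+1)$. $H_n^D$ is its Hecke algebra over $\mathbb{C}[q^{1/2},q^{-1/2}]$, generated by $T_s$ ($s\in S_n^D$) with $T_s^2=(q-1)T_s+q$ and the braid relations of $D_n$; $T_w$ is the product of the $T_s$ along any reduced expression of $w$. $H_J$ is the subalgebra generated by $\{T_s:s\in J\}$; its trivial representation sends $T_u\mapsto q^{\ell(u)}$ and its sign representation sends $T_u\mapsto(-1)^{\ell(u)}$; induction is $H_n^D\otimes_{H_J}(-)$. The signed composition corresponding to $J$ is $\lambda$ where $(|\lambda_1|,\ldots,|\lambda_p|)$ is the composition of $n$ obtained from $n$ dots with a bar between dots $i$ and $i+1$ exactly when $s_i\notin J$, and $\lambda_1<0$ if $t\in J$, all other parts positive (so the parabolic subgroup is $\mathfrak S_{\lambda_1}\times\cdots\times\mathfrak S_{\lambda_p}$, or $D_{|\lambda_1|}\times\mathfrak S_{\lambda_2}\times\cdots$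 if $t\in J$). An element $w$ is parabolic of type $K$ if it is a product of the elements of $K$, each appearing once, in some order.
   Formalization: Two misprints that make the claim false are corrected: (4) is read as ''a_i = −1 for at most one i'' (printed: a_i ≠ −1), and in (6) the case |a_1|=|a_2| is read as ''a_1<0 or a_2<0, or a_1=a_2=1 and t∈J'' (printed without a_1<0). *)

(* Defs.v *)
From HB Require Import structures.
From mathcomp Require Import all_boot all_order all_algebra all_fingroup.
From mathcomp Require Import mathcomp_extra boolp classical_sets fsbigop reals.
From mathcomp Require Import complex.

Set Implicit Arguments.
Unset Strict Implicit.
Unset Printing Implicit Defensive.

Import Order.TTheory GRing.Theory Num.Theory.
Local Open Scope ring_scope.

Section Laurent.
Variable F : fieldType.

Definition laurent_pred : {pred {fraction {poly F}}} := fun x =>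
  `[< exists (p : {poly F}) (k : nat), x = tofrac p / tofrac 'X ^+ k >].

Let X_neq0 k : (tofrac ('X : {poly F})) ^+ k != 0.
Proof. by rewrite expf_neq0 // tofrac_eq0 polyX_eq0. Qed.

Fact laurent_subring : subring_closed laurent_pred.
Proof.
split.
- by apply/asboolP; exists 1, 0%N; rewrite rmorph1 expr0 divr1.
- move=> x y /asboolP [p [k ->]] /asboolP [p' [k' ->]]; apply/asboolP.
  exists (p * 'X^k' - p' * 'X^k), (k + k')%N.
  rewrite rmorphB !rmorphM !rmorphXn /= mulrBl exprD.
  by rewrite -mulf_div divff // mulr1 [tofrac 'X ^+ k * _]mulrC
    -mulf_div divff // mulr1.
- move=> x y /asboolP [p [k ->]] /asboolP [p' [k' ->]]; apply/asboolP.
  by exists (p * p'), (k + k')%N; rewrite rmorphM exprD mulf_div.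
Qed.
HB.instance Definition _ :=
  GRing.isSubringClosed.Build _ laurent_pred laurent_subring.

(* F[v, v^-1], as the ring of the fractions p / v^k inside F(v). *)
Record laurent : predArgType :=
  Laurent { laurent_val : {fraction {poly F}}; _ : laurent_val \in laurent_pred }.
HB.instance Definition _ := [isSub for laurent_val].
HB.instance Definition _ := [Choice of laurent by <:].
HB.instance Definition _ := [SubChoice_isSubComNzRing of laurent by <:].

Fact laurentX_subproof : tofrac ('X : {poly F}) \in laurent_pred.
Proof. by apply/asboolP; exists 'X, 0%N; rewrite expr0 divr1. Qed.
Definition laurentX : laurent := Laurent laurentX_subproof.

End Laurent.

(* C[q^(1/2), q^(-1/2)] and its element q. *)
Definition heckeRing (R : realType) : comNzRingType := laurent (complex R).
Definition hecke_q (R : realType) : heckeRing R := laurentX (complex R) ^+ 2.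

(* The rank of the Coxeter group is written n.+2, so that it ranges over the integers >= 2.
   Positions are elements of 'I_n.+2, hence shifted by one: the ordinal i stands
   for the position i + 1.  The pair (i, b) stands for the signed integer
   i + 1 if b = false, and - (i + 1) if b = true. *)

Definition signed (n : nat) : finType := ('I_n * bool)%type.
Definition sneg n (x : signed n) : signed n := (x.1, ~~ x.2).

Definition typeD n : {set {perm signed n}} :=
  [set w : {perm signed n} | [forall x, w (sneg x) == sneg (w x)]
           & ~~ odd #|[set i : 'I_n | (w (i, false)).2]|].

(* None is t, and Some i is s_(i + 1). *)
Definition dgen (n : nat) : finType := option 'I_n.+1.
Definition gt {n} : dgen n := None.
Definition gs {n} (i : 'I_n.+1) : dgen n := Some i.

(* The positions i and i + 1 exchanged by s_i. *)
Definition pos_l {n} (i : 'I_n.+1) : 'I_n.+2 := widen_ord (leqnSn n.+1) i.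
Definition pos_r {n} (i : 'I_n.+1) : 'I_n.+2 := lift ord0 i.

Definition pos1 {n} : 'I_n.+2 := ord0.
Definition pos2 {n} : 'I_n.+2 := lift ord0 ord0.

Definition dgen_perm n (s : dgen n) : {perm signed n.+2} :=
  match s with
  | None => tperm (pos1, false) (pos2, true) * tperm (pos1, true) (pos2, false)
  | Some i => tperm (pos_l i, false) (pos_r i, false)
              * tperm (pos_l i, true) (pos_r i, true)
  end%g.

(* The product of a word in the group.  Products of mathcomp permutations compose
   from left to right, whence the reversal. *)
Definition word_perm n (r : seq (dgen n)) : {perm signed n.+2} :=
  (\prod_(s <- rev r) dgen_perm s)%g.

Definition reduced_expr n (w : {perm signed n.+2}) (r : seq (dgen n)) : Prop :=
  word_perm r = w /\
  forall r' : seq (dgen n), word_perm r' = w -> (size r <= size r')%N.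

Definition parabolic_of_type n (K : {set dgen n}) (w : {perm signed n.+2}) : Prop :=
  exists2 r : seq (dgen n), perm_eq r (enum K) & word_perm r = w.

(* Adjacency in the Dynkin diagram: t is joined to s_2 only. *)
Definition linked n (x y : dgen n) : bool :=
  match x, y with
  | None, None => false
  | None, Some i | Some i, None => val i == 1%N
  | Some i, Some j => (val i == j.+1) || (val j == i.+1)
  end.

Section Hecke.
Variables (A : comNzRingType) (n : nat).

Inductive hterm : Type :=
  | HGen of dgen n
  | HCst of A
  | HAdd of hterm & hterm
  | HMul of hterm & hterm.

HB.instance Definition _ := gen_eqMixin hterm.
HB.instance Definition _ := gen_choiceMixin hterm.

Variable q : A.

(* The smallest congruence that makes hterm an associative unital A-algebra and
   contains the quadratic and braid relations. *)
Inductive heq : hterm -> hterm -> Prop :=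
  | heq_refl x : heq x x
  | heq_sym x y : heq x y -> heq y x
  | heq_trans x y z : heq x y -> heq y z -> heq x z
  | heq_add x x' y y' : heq x x' -> heq y y' -> heq (HAdd x y) (HAdd x' y')
  | heq_mul x x' y y' : heq x x' -> heq y y' -> heq (HMul x y) (HMul x' y')
  | heq_addA x y z : heq (HAdd x (HAdd y z)) (HAdd (HAdd x y) z)
  | heq_addC x y : heq (HAdd x y) (HAdd y x)
  | heq_add0 x : heq (HAdd (HCst 0) x) x
  | heq_addN x : heq (HAdd (HMul (HCst (-1)) x) x) (HCst 0)
  | heq_mulA x y z : heq (HMul x (HMul y z)) (HMul (HMul x y) z)
  | heq_mul1 x : heq (HMul (HCst 1) x) x
  | heq_mulDl x y z : heq (HMul (HAdd x y) z) (HAdd (HMul x z) (HMul y z))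
  | heq_mulDr x y z : heq (HMul x (HAdd y z)) (HAdd (HMul x y) (HMul x z))
  | heq_cstD a b : heq (HCst (a + b)) (HAdd (HCst a) (HCst b))
  | heq_cstM a b : heq (HCst (a * b)) (HMul (HCst a) (HCst b))
  | heq_cstC a x : heq (HMul (HCst a) x) (HMul x (HCst a))
  | heq_quad s : heq (HMul (HGen s) (HGen s))
                     (HAdd (HMul (HCst (q - 1)) (HGen s)) (HCst q))
  | heq_braid2 s s' : s != s' -> ~~ linked s s' ->
      heq (HMul (HGen s) (HGen s')) (HMul (HGen s') (HGen s))
  | heq_braid3 s s' : linked s s' ->
      heq (HMul (HMul (HGen s) (HGen s')) (HGen s))
          (HMul (HMul (HGen s') (HGen s)) (HGen s')).

Definition heqb : rel hterm := fun x y => `[< heq x y >].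

Fact heqb_equiv : equiv_class_of heqb.
Proof.
split.
- by move=> x; apply/asboolP/heq_refl.
- by move=> x y; apply/asboolP/asboolP; apply: heq_sym.
- by move=> y x z /asboolP xy /asboolP yz; apply/asboolP/(heq_trans xy yz).
Qed.
Canonical heqb_equiv_rel := EquivRelPack heqb_equiv.

Definition hecke : Type := {eq_quot heqb}%qT.
HB.instance Definition _ := Choice.on hecke.

Definition hpi (x : hterm) : hecke := (\pi_{eq_quot heqb} x)%qT.
Definition hrepr (x : hecke) : hterm := generic_quotient.repr (x : {eq_quot heqb}%qT).

Lemma hreprK : cancel hrepr hpi.
Proof. by move=> x; rewrite /hpi /hrepr reprK. Qed.

Lemma hpiP x y : hpi x = hpi y <-> heq x y.
Proof.
by split=> [/eqmodP/asboolP//|xy]; apply/eqmodP/asboolP.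
Qed.

Lemma hrepr_pi x : heq (hrepr (hpi x)) x.
Proof. by apply/hpiP; rewrite hreprK. Qed.

Definition hadd (x y : hecke) := hpi (HAdd (hrepr x) (hrepr y)).
Definition hmul (x y : hecke) := hpi (HMul (hrepr x) (hrepr y)).
Definition hopp (x : hecke) := hpi (HMul (HCst (-1)) (hrepr x)).
Definition hscale (a : A) (x : hecke) := hpi (HMul (HCst a) (hrepr x)).

Lemma hpiD x y : hpi (HAdd x y) = hadd (hpi x) (hpi y).
Proof. by apply/hpiP/heq_add; apply/heq_sym/hrepr_pi. Qed.
Lemma hpiM x y : hpi (HMul x y) = hmul (hpi x) (hpi y).
Proof. by apply/hpiP/heq_mul; apply/heq_sym/hrepr_pi. Qed.

Fact haddA : associative hadd.
Proof.
move=> x y z; rewrite -[x]hreprK -[y]hreprK -[z]hreprK -!hpiD.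
exact/hpiP/heq_addA.
Qed.
Fact haddC : commutative hadd.
Proof. by move=> x y; apply/hpiP/heq_addC. Qed.
Fact hadd0 : left_id (hpi (HCst 0)) hadd.
Proof. by move=> x; rewrite -[x]hreprK -hpiD; apply/hpiP/heq_add0. Qed.
Fact haddN : left_inverse (hpi (HCst 0)) hopp hadd.
Proof.
by move=> x; rewrite /hopp -{2}[x]hreprK -hpiD; apply/hpiP/heq_addN.
Qed.
HB.instance Definition _ := GRing.isZmodule.Build hecke haddA haddC hadd0 haddN.

Lemma hpi_add x y : hpi (HAdd x y) = hpi x + hpi y. Proof. exact: hpiD. Qed.

Section OneDim.
Variable c : A.

Fixpoint hterm_eval (x : hterm) : A :=
  match x with
  | HGen _ => c
  | HCst a => a
  | HAdd x y => hterm_eval x + hterm_eval y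
  | HMul x y => hterm_eval x * hterm_eval y
  end.

(* The value at h of the one-dimensional representation that sends each T_s to c;
   there is such a representation when c is a root of X^2 - (q - 1) X - q. *)
Definition hecke_eval (h : hecke) : A := hterm_eval (hrepr h).

Hypothesis c_root : c * c = (q - 1) * c + q.

Lemma heq_eval x y : heq x y -> hterm_eval x = hterm_eval y.
Proof.
elim=> //=.
- by move=> x' y' z _ -> _ ->.
- by move=> ? ? ? ? _ -> _ ->.
- by move=> ? ? ? ? _ -> _ ->.
- by move=> *; rewrite addrA.
- by move=> *; rewrite addrC.
- by move=> *; rewrite add0r.
- by move=> z; rewrite mulN1r addNr.
- by move=> *; rewrite mulrA.
- by move=> *; rewrite mul1r.
- by move=> *; rewrite mulrDl.
- by move=> *; rewrite mulrDr.
- by move=> *; rewrite mulrC.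
Qed.

Lemma hecke_eval_pi x : hecke_eval (hpi x) = hterm_eval x.
Proof. exact/heq_eval/hrepr_pi. Qed.

End OneDim.

Fact q_root : q * q = (q - 1) * q + q.
Proof. by rewrite mulrBl mul1r subrK. Qed.
Fact m1_root : -1 * -1 = (q - 1) * -1 + q.
Proof. by rewrite mulrN1 opprK mulrN1 opprB subrK. Qed.

Fact hmulA : associative hmul.
Proof.
move=> x y z; rewrite -[x]hreprK -[y]hreprK -[z]hreprK -!hpiM.
exact/hpiP/heq_mulA.
Qed.
Fact hmul1l : left_id (hpi (HCst 1)) hmul.
Proof. by move=> x; rewrite -[x]hreprK -hpiM; apply/hpiP/heq_mul1. Qed.
Fact hmul1r : right_id (hpi (HCst 1)) hmul.
Proof.
move=> x; rewrite -[x]hreprK -hpiM; apply/hpiP.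
exact: heq_trans (heq_sym (heq_cstC _ _)) (heq_mul1 _).
Qed.
Fact hmulDl : left_distributive hmul hadd.
Proof.
move=> x y z; rewrite -[x]hreprK -[y]hreprK -[z]hreprK.
rewrite -(hpiD (hrepr x)) -(hpiM _ (hrepr z)) -(hpiM (hrepr x)).
by rewrite -(hpiM (hrepr y)) -hpiD; apply/hpiP/heq_mulDl.
Qed.
Fact hmulDr : right_distributive hmul hadd.
Proof.
move=> x y z; rewrite -[x]hreprK -[y]hreprK -[z]hreprK.
rewrite -(hpiD (hrepr y)) -(hpiM _ (HAdd _ _)) -(hpiM _ (hrepr y)).
by rewrite -(hpiM _ (hrepr z)) -hpiD; apply/hpiP/heq_mulDr.
Qed.
Fact hone_neq0 : hpi (HCst 1) != 0.
Proof.
apply/eqP => /hpiP /(heq_eval q_root) /= /eqP.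
by rewrite oner_eq0.
Qed.
HB.instance Definition _ := GRing.Zmodule_isNzRing.Build hecke
  hmulA hmul1l hmul1r hmulDl hmulDr hone_neq0.

Lemma hpi_mul x y : hpi (HMul x y) = hpi x * hpi y. Proof. exact: hpiM. Qed.

Lemma hscaleE a x : hscale a x = hpi (HCst a) * x.
Proof. by rewrite -[x in RHS]hreprK -hpi_mul. Qed.
Lemma hcstD a b : hpi (HCst (a + b)) = hpi (HCst a) + hpi (HCst b).
Proof. by rewrite -hpi_add; apply/hpiP/heq_cstD. Qed.
Lemma hcstM a b : hpi (HCst (a * b)) = hpi (HCst a) * hpi (HCst b).
Proof. by rewrite -hpi_mul; apply/hpiP/heq_cstM. Qed.
Lemma hcstC a x : hpi (HCst a) * x = x * hpi (HCst a).
Proof. by rewrite -[x]hreprK -!hpi_mul; apply/hpiP/heq_cstC. Qed.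

Fact hscaleA a b x : hscale a (hscale b x) = hscale (a * b) x.
Proof. by rewrite !hscaleE hcstM mulrA. Qed.
Fact hscale1 : left_id 1 hscale.
Proof. by move=> x; rewrite hscaleE; apply: mul1r. Qed.
Fact hscaleDr : right_distributive hscale +%R.
Proof. by move=> a x y; rewrite !hscaleE mulrDr. Qed.
Fact hscaleDl x : {morph hscale^~ x : a b / a + b}.
Proof. by move=> a b; rewrite !hscaleE hcstD mulrDl. Qed.
HB.instance Definition _ := GRing.Zmodule_isLmodule.Build A hecke
  hscaleA hscale1 hscaleDr hscaleDl.

Fact hscaleAl (a : A) (x y : hecke) : a *: (x * y) = (a *: x) * y.
Proof. by rewrite /GRing.scale /= !hscaleE mulrA. Qed.
HB.instance Definition _ := GRing.Lmodule_isLalgebra.Build A hecke hscaleAl.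
Fact hscaleAr (a : A) (x y : hecke) : a *: (x * y) = x * (a *: y).
Proof. by rewrite /GRing.scale /= !hscaleE mulrA hcstC -mulrA hcstC. Qed.
HB.instance Definition _ := GRing.Lalgebra_isAlgebra.Build A hecke hscaleAr.

Definition hecke_T (s : dgen n) : hecke := hpi (HGen s).

(* This is T_w when r is a reduced expression of w. *)
Definition hecke_Tword (r : seq (dgen n)) : hecke := \prod_(s <- r) hecke_T s.

Inductive parabolic_subalg (J : {set dgen n}) : hecke -> Prop :=
  | psub_gen s : s \in J -> parabolic_subalg J (hecke_T s)
  | psub_cst (a : A) : parabolic_subalg J a%:A
  | psub_add x y : parabolic_subalg J x -> parabolic_subalg J y ->
      parabolic_subalg J (x + y)
  | psub_mul x y : parabolic_subalg J x -> parabolic_subalg J y ->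
      parabolic_subalg J (x * y).

Lemma hcstE (a : A) : hpi (HCst a) = a%:A.
Proof. by rewrite [RHS]hscaleE mulr1. Qed.

Lemma hecke_evalD c : c * c = (q - 1) * c + q ->
  {morph hecke_eval c : x y / x + y}.
Proof. by move=> hc x y; rewrite /GRing.add /= hecke_eval_pi. Qed.
Lemma hecke_evalM c : c * c = (q - 1) * c + q ->
  {morph hecke_eval c : x y / x * y}.
Proof. by move=> hc x y; rewrite {1}/GRing.mul /= hecke_eval_pi. Qed.
Lemma hecke_eval_cst c (a : A) : c * c = (q - 1) * c + q ->
  hecke_eval c a%:A = a.
Proof. by move=> hc; rewrite -hcstE hecke_eval_pi. Qed.
Lemma hecke_eval_Tword c r : c * c = (q - 1) * c + q ->
  hecke_eval c (hecke_Tword r) = c ^+ size r.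
Proof.
move=> hc; rewrite /hecke_Tword; elim: r => [|s r IHr].
  by rewrite big_nil -[1 in LHS]scale1r hecke_eval_cst // expr0.
by rewrite big_cons hecke_evalM // IHr hecke_eval_pi // exprS.
Qed.

Definition triv_rep : hecke -> A := hecke_eval q.
Definition sign_rep : hecke -> A := hecke_eval (-1).

Lemma triv_rep_Tword r : triv_rep (hecke_Tword r) = q ^+ size r.
Proof. exact: hecke_eval_Tword q_root. Qed.
Lemma sign_rep_Tword r : sign_rep (hecke_Tword r) = (-1) ^+ size r.
Proof. exact: hecke_eval_Tword m1_root. Qed.

End Hecke.

(* For a ring H, a subring B and a left B-module V, with u : B acting on V by
   rho u, the left H-module H (x)_B V, as the quotient of the free abelian group
   on the symbols h (x) v by biadditivity and by hu (x) v = h (x) uv for u in B. *)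

Section Induced.
Variables (H : pzRingType) (V : zmodType).

Inductive tterm : Type :=
  | TPure of H & V
  | TZero
  | TOpp of tterm
  | TAdd of tterm & tterm.

HB.instance Definition _ := gen_eqMixin tterm.
HB.instance Definition _ := gen_choiceMixin tterm.

Variables (B : H -> Prop) (rho : H -> V -> V).

Inductive teq : tterm -> tterm -> Prop :=
  | teq_refl x : teq x x
  | teq_sym x y : teq x y -> teq y x
  | teq_trans x y z : teq x y -> teq y z -> teq x z
  | teq_opp x x' : teq x x' -> teq (TOpp x) (TOpp x')
  | teq_add x x' y y' : teq x x' -> teq y y' -> teq (TAdd x y) (TAdd x' y')
  | teq_addA x y z : teq (TAdd x (TAdd y z)) (TAdd (TAdd x y) z)
  | teq_addC x y : teq (TAdd x y) (TAdd y x)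
  | teq_add0 x : teq (TAdd TZero x) x
  | teq_addN x : teq (TAdd (TOpp x) x) TZero
  | teq_pureDl h h' v : teq (TPure (h + h') v) (TAdd (TPure h v) (TPure h' v))
  | teq_pureDr h v v' : teq (TPure h (v + v')) (TAdd (TPure h v) (TPure h v'))
  | teq_bal h u v : B u -> teq (TPure (h * u) v) (TPure h (rho u v)).

Definition teqb : rel tterm := fun x y => `[< teq x y >].

Fact teqb_equiv : equiv_class_of teqb.
Proof.
split.
- by move=> x; apply/asboolP/teq_refl.
- by move=> x y; apply/asboolP/asboolP; apply: teq_sym.
- by move=> y x z /asboolP xy /asboolP yz; apply/asboolP/(teq_trans xy yz).
Qed.
Canonical teqb_equiv_rel := EquivRelPack teqb_equiv.

Definition induced : Type := {eq_quot teqb}%qT.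
HB.instance Definition _ := Choice.on induced.

Definition tpi (x : tterm) : induced := (\pi_{eq_quot teqb} x)%qT.
Definition trepr (x : induced) : tterm := generic_quotient.repr (x : {eq_quot teqb}%qT).

Lemma treprK : cancel trepr tpi.
Proof. by move=> x; rewrite /tpi /trepr reprK. Qed.
Lemma tpiP x y : tpi x = tpi y <-> teq x y.
Proof. by split=> [/eqmodP/asboolP//|xy]; apply/eqmodP/asboolP. Qed.
Lemma trepr_pi x : teq (trepr (tpi x)) x.
Proof. by apply/tpiP; rewrite treprK. Qed.

Definition tadd (x y : induced) := tpi (TAdd (trepr x) (trepr y)).
Definition topp (x : induced) := tpi (TOpp (trepr x)).

Lemma tpiD x y : tpi (TAdd x y) = tadd (tpi x) (tpi y).
Proof. by apply/tpiP/teq_add; apply/teq_sym/trepr_pi. Qed.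

Fact taddA : associative tadd.
Proof.
move=> x y z; rewrite -[x]treprK -[y]treprK -[z]treprK -!tpiD.
exact/tpiP/teq_addA.
Qed.
Fact taddC : commutative tadd.
Proof. by move=> x y; apply/tpiP/teq_addC. Qed.
Fact tadd0 : left_id (tpi TZero) tadd.
Proof. by move=> x; rewrite -[x]treprK -tpiD; apply/tpiP/teq_add0. Qed.
Fact taddN : left_inverse (tpi TZero) topp tadd.
Proof.
by move=> x; rewrite /topp -{2}[x]treprK -tpiD; apply/tpiP/teq_addN.
Qed.
HB.instance Definition _ :=
  GRing.isZmodule.Build induced taddA taddC tadd0 taddN.

Fixpoint tterm_act (h : H) (x : tterm) : tterm :=
  match x with
  | TPure h' v => TPure (h * h') v
  | TZero => TZero
  | TOpp x => TOpp (tterm_act h x)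
  | TAdd x y => TAdd (tterm_act h x) (tterm_act h y)
  end.

Lemma teq_act h x y : teq x y -> teq (tterm_act h x) (tterm_act h y).
Proof.
elim=> /=; try by eauto using teq.
- by move=> h1 h2 v; rewrite mulrDr; apply: teq_pureDl.
- by move=> h1 u v Bu; rewrite mulrA; apply: teq_bal.
Qed.

Definition tact (h : H) (x : induced) : induced := tpi (tterm_act h (trepr x)).

Lemma tact_pi h x : tact h (tpi x) = tpi (tterm_act h x).
Proof. exact/tpiP/teq_act/trepr_pi. Qed.
Lemma tpi_add x y : tpi (TAdd x y) = tpi x + tpi y. Proof. exact: tpiD. Qed.
Lemma tpi_opp x : tpi (TOpp x) = - tpi x.
Proof. by apply/tpiP/teq_opp/teq_sym/trepr_pi. Qed.

Fact tactA h h' x : tact h (tact h' x) = tact (h * h') x.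
Proof.
rewrite -[x]treprK !tact_pi; congr tpi.
by elim: (trepr x) => //= [h1 v|y ->|y -> z ->] //; rewrite mulrA.
Qed.
Fact tact1 : left_id 1 tact.
Proof.
move=> x; rewrite -[x]treprK tact_pi; congr tpi.
by elim: (trepr x) => //= [h1 v|y ->|y -> z ->] //; rewrite mul1r.
Qed.
Fact tactDr : right_distributive tact +%R.
Proof.
by move=> h x y; rewrite -[x]treprK -[y]treprK -tpi_add !tact_pi -tpi_add.
Qed.
Fact tactDl x : {morph tact^~ x : h h' / h + h'}.
Proof.
move=> h h'; rewrite -[x]treprK !tact_pi.
elim: (trepr x) => /= [h1 v||y IHy|y IHy z IHz].
- by rewrite mulrDl -tpi_add; apply/tpiP/teq_pureDl.
- by rewrite -[RHS]tpi_add; apply/tpiP/teq_sym/teq_add0.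
- by rewrite !tpi_opp IHy opprD.
- by rewrite !tpi_add IHy IHz addrACA.
Qed.
HB.instance Definition _ := GRing.Zmodule_isLmodule.Build H induced
  tactA tact1 tactDr tactDl.

End Induced.

(* M is a left module over an A-algebra H, seen as an A-module through A -> H.
   The character of M at h is the trace of h in a finite A-basis of M. *)

Section Character.
Variables (A : comNzRingType) (H : lalgType A) (M : lmodType H).

Definition is_basis r (b : 'I_r -> M) : Prop :=
  forall x, exists! c : 'rV[A]_r, x = \sum_i (c 0 i)%:A *: b i.

Definition is_trace (h : H) (c : A) : Prop :=
  exists r (b : 'I_r -> M) (X : 'M[A]_r),
    [/\ is_basis b, forall j, h *: b j = \sum_i (X i j)%:A *: b i & c = \tr X].

(* The value does not depend on the basis; it is 0 if there is no finite basis. *)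
Definition char_of (h : H) : A := xget 0 [set c | is_trace h c]%classic.

End Character.

Section Formula.
Variable n : nat.
Implicit Types (J K : {set dgen n}) (a : {ffun 'I_n.+2 -> int}).

(* The number of bars to the left of the dot i. *)
Definition bars_before J (i : 'I_n.+2) : nat :=
  #|[set j : 'I_n.+1 | (j < i)%N && (gs j \notin J)]|.

(* Entry k of the list is the part numbered k + 1. *)
Definition signed_comp J : seq int :=
  mkseq (fun k => let c := #|[set i : 'I_n.+2 | bars_before J i == k]| in
                  if (k == 0%N) && (gt \in J) then - c%:Z else c%:Z)
        #|[set j : 'I_n.+1 | gs j \notin J]|.+1.

(* s_i fixes the coset of a when a_i = a_(i+1), or when t \in J and
   {a_i, a_(i+1)} = {1, -1}, of which only a_i = -1 is a normal form; it is a
   descent when a_i > a_(i+1).  Likewise t, which acts by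
   (a_1, a_2) |-> (- a_2, - a_1), fixes the coset when a_1 = - a_2, for either
   sign of a_1, or when t \in J and a_1 = a_2 = 1. *)
Record admissible J K a : Prop := Admissible {
  adm_range : forall i, (1 <= `|a i| <= size (signed_comp J))%N;
  adm_content : forall k, (k < size (signed_comp J))%N ->
    #|[set i | `|a i|%N == k.+1]| = `|nth 0%R (signed_comp J) k|%N;
  adm_even : ~~ odd #|[set i | (a i < 0)%R]|;
  adm_normal : gt \in J -> (#|[set i | (a i == -1)%R]| <= 1)%N /\
    forall i, a i = -1 -> forall j : 'I_n.+2, (j < i)%N -> a j <> 1;
  adm_s : forall i : 'I_n.+1, gs i \in K ->
    a (pos_r i) <= a (pos_l i) \/
    [/\ gt \in J, a (pos_l i) = -1 & a (pos_r i) = 1];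
  adm_t : gt \in K ->
    [/\ (`|a pos2| < `|a pos1|)%N -> a pos1 < 0,
        (`|a pos1| < `|a pos2|)%N -> a pos2 < 0
      & `|a pos1|%N = `|a pos2|%N ->
        [\/ a pos1 < 0, a pos2 < 0 | [/\ a pos1 = 1, a pos2 = 1 & gt \in J]]]
}.

Definition stat_d K a : nat :=
  #|[set i : 'I_n.+1 | (gs i \in K) && (a (pos_r i) < a (pos_l i))]|.
Definition stat_e K a : nat :=
  #|[set i : 'I_n.+1 | (gs i \in K) && (a (pos_l i) <= a (pos_r i))]|.
Definition stat_f K a : nat :=
  (gt \in K) && (((a pos1 == a pos2) && (a pos2 < 0))
                 || (`|a pos1|%N != `|a pos2|%N)).
Definition stat_g K a : nat :=
  (gt \in K) && ((a pos1 == - a pos2) || ((a pos1 == 1) && (a pos2 == 1))).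

End Formula.

Section InducedCharacters.
Variables (R : realType) (n : nat) (J : {set dgen n}).
Let H : algType (heckeRing R) := hecke n (hecke_q R).

Definition eta : H -> heckeRing R :=
  char_of (induced (parabolic_subalg J) (fun (u : H) (v : heckeRing R) => triv_rep u * v)).
Definition epsilon : H -> heckeRing R :=
  char_of (induced (parabolic_subalg J) (fun (u : H) (v : heckeRing R) => sign_rep u * v)).

End InducedCharacters.

(* Main.v *)
Require Import Defs.
From mathcomp Require Import all_boot all_order all_algebra all_fingroup.
From mathcomp Require Import boolp classical_sets fsbigop reals.
From mathcomp Require Import zify ring.

(* The cosets of the parabolic subgroup are the points of the D_n-orbit of a
   dominant vector v0 of Z^n whose stabiliser is generated by J.  The sign of the
   pairing of v with the simple root of s tells whether s raises, fixes or lowers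
   the coset v.  The Hecke algebra acts on the functions on this orbit; this
   module is the induced one, because a map out of it can be built along
   ascending paths from v0, two descents of v being resolved inside a dihedral
   orbit.  A fundamental coweight changes only under its own generator, so when
   each generator is used once a closed path in the orbit never moves, and the
   trace of T_w is the sum over the orbit of the products of the diagonal
   coefficients of the T_s, s in K.  The same coweights show that any reduced
   expression of w is a rearrangement of K.  The sequences a of the theorem are
   the points of the orbit with the entries 0 (present when t is in J) written
   1 or -1. *)

Set Implicit Arguments.
Unset Strict Implicit.
Unset Printing Implicit Defensive.

Import Order.TTheory GRing.Theory Num.Theory.
Local Open Scope ring_scope.

(** * Independence of the trace from the basis *)

Section Trace.
Variables (A : comNzRingType) (H : algType A) (M : lmodType H).

(** With [P] and [Q] the two transition matrices, [X = P X' Q] and [Q P = 1], so the cyclicity of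
    the trace concludes. [P] and [Q] may be rectangular: the ranks are never compared. *)
Lemma is_trace_inj (h : H) (c c' : A) :
  is_trace M h c -> is_trace M h c' -> c = c'.
Proof.
move=> [r [b [X [bb hb ->]]]] [r' [b' [X' [bb' hb' ->]]]].
have coord m (e : 'I_m -> M) : is_basis e ->
    forall k (e' : 'I_k -> M), exists P : 'M[A]_(m, k),
    forall j, e' j = \sum_i (P i j)%:A *: e i.
  move=> be k e'; have /choice[C hC] j : exists c : 'rV[A]_m,
      e' j = \sum_i (c 0 i)%:A *: e i.
    by have [x [hx _]] := be (e' j); exists x.
  exists (\matrix_(i, j) C j 0 i) => j; rewrite [LHS]hC.
  by apply: eq_bigr => i _; rewrite mxE.
have comp m k l (e : 'I_m -> M) (e' : 'I_k -> M) (e'' : 'I_l -> M)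
    (P : 'M[A]_(m, k)) (Q : 'M[A]_(k, l)) :
    (forall j, e' j = \sum_i (P i j)%:A *: e i) ->
    (forall j, e'' j = \sum_i (Q i j)%:A *: e' i) ->
    forall j, e'' j = \sum_i ((P *m Q) i j)%:A *: e i.
  move=> hP hQ j; rewrite hQ.
  under eq_bigr => i _ do rewrite hP scaler_sumr.
  rewrite exchange_big /=; apply: eq_bigr => i _.
  rewrite mxE scaler_suml scaler_suml; apply: eq_bigr => k' _.
  by rewrite scalerA -scalerAl mul1r scalerA mulrC.
have uniq_coord m k (e : 'I_m -> M) (e' : 'I_k -> M) (P Q : 'M[A]_(m, k)) :
    is_basis e -> (forall j, e' j = \sum_i (P i j)%:A *: e i) ->
    (forall j, e' j = \sum_i (Q i j)%:A *: e i) -> P = Q.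
  move=> be hP hQ; apply/matrixP => i j.
  have [x [_ hx]] := be (e' j).
  have /hx/rowP/(_ i) : e' j = \sum_i ((row j P^T) 0 i)%:A *: e i.
    by rewrite [LHS]hP; apply: eq_bigr => ? _; rewrite !mxE.
  have /hx/rowP/(_ i) : e' j = \sum_i ((row j Q^T) 0 i)%:A *: e i.
    by rewrite [LHS]hQ; apply: eq_bigr => ? _; rewrite !mxE.
  by rewrite !mxE => <- <-.
have [P hP] := coord _ _ bb _ b'; have [Q hQ] := coord _ _ bb' _ b.
(* Scalars are central in the algebra [H], so [h] acts linearly over [A]. *)
have mulh m k (e : 'I_m -> M) (e' : 'I_k -> M) (Z : 'M[A]_m) (W : 'M[A]_(m, k)) :
    (forall j, h *: e j = \sum_i (Z i j)%:A *: e i) ->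
    (forall j, e' j = \sum_i (W i j)%:A *: e i) ->
    forall j, h *: e' j = \sum_i ((Z *m W) i j)%:A *: e i.
  move=> hZ hW; apply: (comp _ _ _ e (fun j => h *: e j)) => // j.
  rewrite hW scaler_sumr; apply: eq_bigr => i _.
  by rewrite !scalerA mulr_algl mulr_algr.
have QPX : X = P *m (X' *m Q).
  apply: (uniq_coord _ _ b (fun j => h *: b j)) => //.
  exact: (comp _ _ _ _ b') (mulh _ _ _ _ _ _ hb' hQ).
have QP1 : Q *m P = 1%:M.
  apply: (uniq_coord _ _ b' b') => //; first exact: (comp _ _ _ _ b).
  move=> j; rewrite (bigD1 j) //= big1 => [|i /negPf ij].
    by rewrite mxE eqxx !scale1r addr0.
  by rewrite mxE ij !scale0r.
by rewrite QPX mxtrace_mulC -mulmxA QP1 mulmx1.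
Qed.

Lemma char_ofE (h : H) (c : A) : is_trace M h c -> char_of M h = c.
Proof.
move=> hc; rewrite /char_of; case: xgetP => [x _ /= hx|/(_ c)//].
exact: is_trace_inj hx hc.
Qed.

End Trace.

(** * The Hecke module of functions on a reflection set *)

(* rs_f s v stands for the pairing of v with the simple root of s, and rs_om s v
   for its pairing with the fundamental coweight of s. *)
Record reflection_set (n : nat) := ReflectionSet {
  rs_pt :> finType;
  rs_act : dgen n -> rs_pt -> rs_pt;
  rs_f : dgen n -> rs_pt -> int;
  rs_om : dgen n -> rs_pt -> int;
  rs_actK : forall s, involutive (rs_act s);
  rs_act_fix : forall s v, rs_f s v = 0 -> rs_act s v = v;
  rs_act_comm : forall s t v, s != t -> ~~ linked s t ->
    rs_act s (rs_act t v) = rs_act t (rs_act s v);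
  rs_act_braid : forall s t v, linked s t ->
    rs_act s (rs_act t (rs_act s v)) = rs_act t (rs_act s (rs_act t v));
  rs_f_self : forall s v, rs_f s (rs_act s v) = - rs_f s v;
  rs_f_comm : forall s t v, s != t -> ~~ linked s t ->
    rs_f t (rs_act s v) = rs_f t v;
  rs_f_braid : forall s t v, linked s t ->
    rs_f t (rs_act s v) = rs_f t v + rs_f s v;
  rs_om_other : forall s t v, s != t -> rs_om s (rs_act t v) = rs_om s v;
  rs_om_self : forall s v, rs_f s v < 0 -> rs_om s v < rs_om s (rs_act s v)
}.

Lemma linked_sym n (s t : dgen n) : linked s t = linked t s.
Proof. by case: s t => [i|] [j|] //=; rewrite orbC. Qed.

Lemma linked_neq n (s t : dgen n) : linked s t -> s != t.
Proof. by apply: contraTneq => ->; case: t => [i|] //=; lia. Qed.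

Section Module.
Variables (A : comNzRingType) (n : nat) (q c : A) (X : reflection_set n).
Hypothesis c_root : c * c = (q - 1) * c + q.

Local Notation act := (@rs_act n X).
Local Notation f := (@rs_f n X).

(* On indicator functions: T_s e_v is e_(sv), c e_v or q e_(sv) + (q - 1) e_v
   when f s v is positive, zero or negative. *)
Definition mod_T (s : dgen n) (g : X -> A) : X -> A := fun v =>
  if f s v == 0 then c * g v
  else if 0 < f s v then q * g (act s v)
  else g (act s v) + (q - 1) * g v.

Lemma mod_T0 s g v : f s v = 0 -> mod_T s g v = c * g v.
Proof. by rewrite /mod_T => ->. Qed.

Lemma mod_T_gt0 s g v : 0 < f s v -> mod_T s g v = q * g (act s v).
Proof. by rewrite /mod_T => h; rewrite h gt_eqF. Qed.

Lemma mod_T_lt0 s g v : f s v < 0 ->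
  mod_T s g v = g (act s v) + (q - 1) * g v.
Proof. by rewrite /mod_T => h; rewrite lt_eqF // ltNge ltW. Qed.

Lemma mod_T_quad s g v :
  mod_T s (mod_T s g) v = (q - 1) * mod_T s g v + q * g v.
Proof.
have fs := rs_f_self s v; have [h|h|h] := ltgtP (f s v) 0.
- rewrite (mod_T_lt0 _ h) (mod_T_gt0 _ (v := act s v)) ?rs_actK; first by ring.
  by rewrite fs; lia.
- rewrite (mod_T_gt0 _ h) (mod_T_lt0 _ (v := act s v)) ?rs_actK; last first.
    by rewrite fs; lia.
  by rewrite (mod_T_gt0 _ h); ring.
- by rewrite !mod_T0 // mulrA c_root; ring.
Qed.

Ltac mod_T_step :=
  match goal with
  | |- context [mod_T ?s ?g ?v] =>
      first
      [ rewrite (@mod_T0 s g v); [|lia]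
      | rewrite (@mod_T_gt0 s g v); [|lia]
      | rewrite (@mod_T_lt0 s g v); [|lia] ]
  end.

Lemma mod_T_comm s t g v : s != t -> ~~ linked s t ->
  mod_T s (mod_T t g) v = mod_T t (mod_T s g) v.
Proof.
move=> st lst; have ts : t != s by rewrite eq_sym.
have lts : ~~ linked t s by rewrite linked_sym.
have e1 := rs_f_comm v st lst; have e2 := rs_f_comm v ts lts.
have ec := rs_act_comm v st lst.
by have [hs|hs|hs] := ltgtP (f s v) 0; have [ht|ht|ht] := ltgtP (f t v) 0;
  repeat mod_T_step; rewrite ?ec; ring.
Qed.

(** The signs of the pairings of [v] with [s], with [t] and with their sum determine every branch of
    [mod_T] along the [<s, t>]-orbit of [v]; each sign pattern leaves one polynomial identity. *)
Lemma mod_T_braid s t g v : linked s t ->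
  mod_T s (mod_T t (mod_T s g)) v = mod_T t (mod_T s (mod_T t g)) v.
Proof.
move=> lst; have lts : linked t s by rewrite linked_sym.
have := rs_act_braid v lst.
have := rs_f_braid v lst; have := rs_f_braid v lts.
have := rs_f_self s v; have := rs_f_self t v.
have := rs_f_braid (act s v) lts; have := rs_f_braid (act t v) lst.
have := rs_f_self t (act s v); have := rs_f_self s (act t v).
have := rs_actK s v; have := rs_actK t v.
have := rs_actK t (act s v); have := rs_actK s (act t v).
have := @rs_act_fix _ X s v; have := @rs_act_fix _ X t v.
have := @rs_act_fix _ X t (act s v); have := @rs_act_fix _ X s (act t v).
have := @rs_act_fix _ X t (act s (act t v)).
have := @rs_act_fix _ X s (act t (act s v)).
move e1: (act s v) => v1; move e2: (act t v) => v2.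
move e12: (act t v1) => v12; move e21: (act s v2) => v21.
move=> z12 z21 z2 z1 zt zs k21 k12 k2 k1 f21 f12 f2' f1' f2 f1 f2'' f1'' ew.
have [hs|hs|hs] := ltgtP (f s v) 0; have [ht|ht|ht] := ltgtP (f t v) 0;
  have [hst|hst|hst] := ltgtP (f s v + f t v) 0; try (exfalso; lia);
  repeat progress (repeat mod_T_step; rewrite ?e1 ?e2 ?e12 ?e21 ?k1 ?k2 ?k12 ?k21 ?ew).
(* The equation of [c] enters when a pairing vanishes, for instance when [f s v = 0] and
   [f t v < 0]. *)
all: by ring || ring: c_root.
Qed.

Fixpoint hterm_mod (x : hterm A n) (g : X -> A) : X -> A :=
  match x with
  | HGen s => mod_T s g
  | HCst a => fun v => a * g v
  | HAdd x y => fun v => hterm_mod x g v + hterm_mod y g v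
  | HMul x y => hterm_mod x (hterm_mod y g)
  end.

Lemma mod_T_linear s a (g g' : X -> A) :
  mod_T s (fun v => a * g v + g' v) =
  fun v => a * mod_T s g v + mod_T s g' v.
Proof.
by apply/funext => v; rewrite /mod_T; case: ifP => _; [|case: ifP => _]; ring.
Qed.

Lemma hterm_mod_linear x a (g g' : X -> A) :
  hterm_mod x (fun v => a * g v + g' v) =
  fun v => a * hterm_mod x g v + hterm_mod x g' v.
Proof.
elim: x g g' => [s|b|x IHx y IHy|x IHx y IHy] g g' /=.
- exact: mod_T_linear.
- by apply/funext => v; ring.
- by rewrite IHx IHy; apply/funext => v; ring.
- by rewrite IHy IHx.
Qed.

Lemma hterm_modD x (g g' : X -> A) :
  hterm_mod x (fun v => g v + g' v) =
  fun v => hterm_mod x g v + hterm_mod x g' v.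
Proof.
have := hterm_mod_linear x 1 g g'.
by under eq_fun do rewrite mul1r; move=> ->; apply/funext => v; rewrite mul1r.
Qed.

Lemma hterm_mod0 x : hterm_mod x (fun=> 0) = fun=> 0.
Proof.
have := hterm_mod_linear x (-1) (fun=> 0) (fun=> 0).
under eq_fun do rewrite mulr0 addr0.
by move=> h; rewrite h; apply/funext => v; rewrite mulN1r addNr.
Qed.

Lemma hterm_modZ x a (g : X -> A) :
  hterm_mod x (fun v => a * g v) = fun v => a * hterm_mod x g v.
Proof.
have := hterm_mod_linear x a g (fun=> 0).
under eq_fun do rewrite addr0.
by move=> ->; apply/funext => v; rewrite hterm_mod0 addr0.
Qed.

(** This makes the functions on [X] a Hecke module. Linearity takes care of right distributivity and
    of the centrality of scalars, and the three lemmas on [mod_T] take care of the defining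
    relations. *)
Lemma heq_hterm_mod x y : heq q x y -> hterm_mod x = hterm_mod y.
Proof.
move=> xy; apply/funext => g; elim: xy g => //=.
- by move=> {}x {}y z _ xy _ yz g; rewrite xy.
- by move=> x1 x2 y1 y2 _ h1 _ h2 g; rewrite h1 h2.
- by move=> x1 x2 y1 y2 _ h1 _ h2 g; rewrite h1 h2.
- by move=> x1 x2 x3 g; apply/funext => v; rewrite addrA.
- by move=> x1 x2 g; apply/funext => v; rewrite addrC.
- by move=> x1 g; apply/funext => v; rewrite mul0r add0r.
- by move=> x1 g; apply/funext => v; rewrite mulN1r addNr mul0r.
- by move=> x1 g; apply/funext => v; rewrite mul1r.
- by move=> x1 x2 x3 g; rewrite hterm_modD.
- by move=> a b g; apply/funext => v; rewrite mulrDl.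
- by move=> a b g; apply/funext => v; rewrite mulrA.
- by move=> a x1 g; rewrite hterm_modZ.
- by move=> s g; apply/funext => v; rewrite mod_T_quad.
- by move=> s t st lst g; apply/funext => v; rewrite mod_T_comm.
- by move=> s t lst g; apply/funext => v; rewrite mod_T_braid.
Qed.

Definition hecke_mod (h : hecke n q) : (X -> A) -> X -> A :=
  hterm_mod (hrepr h).

Lemma hecke_mod_pi x : hecke_mod (hpi q x) = hterm_mod x.
Proof. exact/heq_hterm_mod/hrepr_pi. Qed.

Lemma hecke_mod_T s : hecke_mod (hecke_T q s) = mod_T s.
Proof. exact: hecke_mod_pi. Qed.

Lemma hecke_mod_add h h' g :
  hecke_mod (h + h') g = fun v => hecke_mod h g v + hecke_mod h' g v.
Proof. by rewrite -[h]hreprK -[h']hreprK -hpi_add !hecke_mod_pi. Qed.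

Lemma hecke_mod_mul h h' g :
  hecke_mod (h * h') g = hecke_mod h (hecke_mod h' g).
Proof. by rewrite -[h]hreprK -[h']hreprK -hpi_mul !hecke_mod_pi. Qed.

Lemma hecke_mod_cst a g : hecke_mod a%:A g = fun v => a * g v.
Proof. by rewrite -hcstE hecke_mod_pi. Qed.

Lemma hecke_mod1 g : hecke_mod 1 g = g.
Proof.
by rewrite -[1]scale1r hecke_mod_cst; apply/funext => v; rewrite mul1r.
Qed.

Lemma hecke_mod_Tword r g : hecke_mod (hecke_Tword q r) g = foldr mod_T g r.
Proof.
rewrite /hecke_Tword; elim: r => [|s r IHr] /=; first by rewrite big_nil hecke_mod1.
by rewrite big_cons hecke_mod_mul IHr hecke_mod_T.
Qed.

(** The coefficient of [g v] in [mod_T s g v]: when [f s v] is not zero, [act s v] is another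
    point. *)
Definition diag_coef (s : dgen n) (v : X) : A :=
  if f s v == 0 then c else if 0 < f s v then 0 else q - 1.

Lemma om_neq s v : f s v != 0 -> rs_om s (act s v) != rs_om s v.
Proof.
have [h _|h _|//] := ltgtP (f s v) 0.
  by rewrite gt_eqF // rs_om_self.
have := @rs_om_self _ X s (act s v).
by rewrite rs_f_self rs_actK oppr_lt0 => /(_ h) /lt_eqF ->.
Qed.

(* Each generator is used at most once and only it changes its own om, so a
   closed path never moves. *)
Lemma trace_Tword (r : seq (dgen n)) (v : X) : uniq r ->
  foldr mod_T (fun u => (u == v)%:R) r v = \prod_(s <- r) diag_coef s v.
Proof.
(* Steps other than [s] preserve [rs_om s], so the indicator of [v] spreads only to points with the
   same value of [rs_om s]. *)
have supp (r' : seq (dgen n)) s u : s \notin r' -> rs_om s u != rs_om s v ->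
    foldr mod_T (fun u => (u == v)%:R) r' u = 0.
  elim: r' u => [|t r' IHr] u /=; first by case: (eqVneq u v) => [->|//]; rewrite eqxx.
  rewrite inE negb_or => /andP[st sr] ou.
  have := IHr (act t u) sr; rewrite rs_om_other // => /(_ ou) h1.
  by rewrite /mod_T h1 (IHr u) //; case: ifP => _; [|case: ifP => _]; ring.
elim: r => [|s r IHr] /=; first by rewrite big_nil eqxx.
move=> /andP[sr /IHr{}IHr]; rewrite big_cons -IHr /mod_T /diag_coef.
case: ifP => // /negbT fs.
rewrite (supp r s (act s v)) ?om_neq //.
by case: ifP => _; ring.
Qed.

End Module.

(** * A basis of the induced module *)

Section HeckeRelations.
Variables (A : comNzRingType) (n : nat) (q : A).
Local Notation T := (hecke_T q).

Lemma hecke_T_quad (s : dgen n) : T s * T s = (q - 1) *: T s + q%:A.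
Proof.
rewrite -hpi_mul -[_ *: _]mulr_algl -!hcstE -hpi_mul -hpi_add.
exact/hpiP/heq_quad.
Qed.

Lemma hecke_T_comm (s t : dgen n) : s != t -> ~~ linked s t ->
  T s * T t = T t * T s.
Proof. by move=> *; rewrite -!hpi_mul; apply/hpiP/heq_braid2. Qed.

Lemma hecke_T_braid (s t : dgen n) : linked s t ->
  T s * T t * T s = T t * T s * T t.
Proof.
move=> st; rewrite /hecke_T -(hpi_mul _ (HGen A s) (HGen A t)).
rewrite -(hpi_mul _ (HGen A t) (HGen A s)) -!hpi_mul.
exact/hpiP/heq_braid3.
Qed.

Lemma hecke_ind (P : hecke n q -> Prop) :
  (forall s, P (T s)) -> (forall a : A, P a%:A) ->
  (forall x y, P x -> P y -> P (x + y)) ->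
  (forall x y, P x -> P y -> P (x * y)) -> forall x, P x.
Proof.
move=> PT PA PD PM x; rewrite -[x]hreprK.
elim: (hrepr x) => [s|a|y Py z Pz|y Py z Pz]; first exact: PT.
- by rewrite hcstE.
- by rewrite hpi_add; apply: PD.
- by rewrite hpi_mul; apply: PM.
Qed.

End HeckeRelations.

(** * Lifting the points to a module along ascending paths *)

Section Reach.
Variables (A : comNzRingType) (n : nat) (q c : A) (X : reflection_set n) (v0 : X).
Hypothesis v0_max : forall v : X, v != v0 -> exists s, rs_f s v < 0.
Hypothesis v0_dom : forall s, 0 <= rs_f s v0.
Local Notation act := (@rs_act n X).
Local Notation f := (@rs_f n X).
Local Notation T := (hecke_T q).

(** An induction measure: the sum of the [rs_om] comes with no bound, but the number of points above
    it is a natural number. *)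
Definition coheight (v : X) : nat :=
  #|[set u : X | \sum_s rs_om s v < \sum_s rs_om s u]|.

(** Only [rs_om s] changes under [s], and it grows; so the counted set shrinks and loses at least
    [act s v]. *)
Lemma coheight_lt s v : f s v < 0 -> (coheight (act s v) < coheight v)%N.
Proof.
move=> fs; have lt : \sum_t rs_om t v < \sum_t rs_om t (act s v).
  rewrite (bigD1 s) //= [ltRHS](bigD1 s) //=.
  rewrite [Z in _ < _ + Z](eq_bigr (fun t => rs_om t v)) => [|t ts].
    by rewrite ltrD2r rs_om_self.
  by rewrite rs_om_other.
apply/proper_card/fintype.properP; split.
  by apply/fintype.subsetP => u; rewrite !inE; apply: lt_trans.
by exists (act s v); rewrite !inE ?ltxx.
Qed.

Variables (N : lmodType (hecke n q)) (y0 : N).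
Hypothesis y0_fix : forall s, f s v0 = 0 -> T s *: y0 = c%:A *: y0.

(** A relation, because several ascending paths lead to the same point. [reach_total] and
    [reach_spec] show that it is the graph of a function. *)
Inductive reach : X -> N -> Prop :=
  | reach0 : reach v0 y0
  | reachS s v y : reach v y -> 0 < f s v -> reach (act s v) (T s *: y).

Lemma reach_down s v y : f s v < 0 -> reach (act s v) y -> reach v (T s *: y).
Proof.
by move=> fs /(@reachS s); rewrite rs_f_self oppr_gt0 rs_actK => /(_ fs).
Qed.

Lemma reach_inv v y : reach v y -> (v = v0 /\ y = y0) \/
  exists s z, [/\ f s v < 0, reach (act s v) z & y = T s *: z].
Proof.
case=> [|s u z uz fs]; first by left.
by right; exists s, z; rewrite rs_f_self oppr_lt0 rs_actK.
Qed.

Lemma reach_total v : exists y, reach v y.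
Proof.
have [m] := ubnP (coheight v); elim: m v => // m IHm v vm.
have [->|/v0_max[s fs]] := eqVneq v v0; first by exists y0; constructor.
have [] := IHm (act s v); first exact: leq_trans (coheight_lt fs) vm.
by move=> y /(reach_down fs); exists (T s *: y).
Qed.

(* Two descents s, t of v are resolved inside the <s, t>-orbit of v, whose
   bottom element lies below both of them. *)
Lemma reach_spec v :
  (forall y y', reach v y -> reach v y' -> y = y') /\
  (forall s y, reach v y -> f s v = 0 -> T s *: y = c%:A *: y).
Proof.
have [m] := ubnP (coheight v); elim: m v => // m IHm v vm.
have IH s : f s v < 0 -> (forall y y', reach (act s v) y -> reach (act s v) y' -> y = y')
    /\ (forall t y, reach (act s v) y -> f t (act s v) = 0 -> T t *: y = c%:A *: y).
  by move=> fs; apply: IHm; apply: leq_trans (coheight_lt fs) vm.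
have IH2 s t : f s v < 0 -> f t (act s v) < 0 ->
    forall u y, reach (act t (act s v)) y -> f u (act t (act s v)) = 0 ->
    T u *: y = c%:A *: y.
  move=> fs ft; apply: (proj2 (IHm (act t (act s v)) _)).
  exact: leq_trans (coheight_lt ft) (ltnW (leq_trans (coheight_lt fs) vm)).
split=> [y y' /reach_inv[[-> ->]|[s [z [fs vz ->]]]] /reach_inv[[]|[t [z' [ft vz' ->]]]]|].
- by [].
- by move: ft; rewrite ltNge v0_dom.
- by move=> e; move: fs; rewrite e ltNge v0_dom.
- have [st|st] := eqVneq s t; first by subst t; rewrite (proj1 (IH s fs) z z').
  have ts : t != s by rewrite eq_sym.
  have [lst|lst] := boolP (linked s t); last first.
    have lts : ~~ linked t s by rewrite linked_sym.
    have [x hx] := reach_total (act s (act t v)).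
    have hx' : reach (act t v) (T s *: x) by apply: reach_down; rewrite ?rs_f_comm.
    have hx'' : reach (act s v) (T t *: x).
      by apply: reach_down; rewrite ?rs_f_comm // -rs_act_comm.
    rewrite (proj1 (IH s fs) z _ vz hx'') (proj1 (IH t ft) z' _ vz' hx').
    by rewrite !scalerA hecke_T_comm.
  have lts : linked t s by rewrite linked_sym.
  have e1 := rs_f_braid v lst; have e2 := rs_f_braid v lts.
  have e3 := rs_f_braid (act s v) lts; have e4 := rs_f_braid (act t v) lst.
  have e5 := rs_f_self s v; have e6 := rs_f_self t v.
  have [x hx] := reach_total (act s (act t (act s v))).
  have hx' : reach (act s v) (T t *: (T s *: x)).
    by do 2 (apply: reach_down; first lia).
  have hx'' : reach (act t v) (T s *: (T t *: x)).
    by do 2 (apply: reach_down; first lia); rewrite -rs_act_braid.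
  rewrite (proj1 (IH s fs) z _ vz hx') (proj1 (IH t ft) z' _ vz' hx'').
  by rewrite !scalerA hecke_T_braid.
- move=> s y /reach_inv[[-> ->]|[t [z [ft vz ->]]]] fs; first exact: y0_fix.
  have st : s != t by apply: contraTneq ft => <-; rewrite fs.
  have ts : t != s by rewrite eq_sym.
  have [lst|lst] := boolP (linked s t); last first.
    have lts : ~~ linked t s by rewrite linked_sym.
    rewrite scalerA hecke_T_comm // -scalerA (proj2 (IH t ft) s) ?rs_f_comm //.
    by rewrite !scalerA mulr_algr mulr_algl.
  have lts : linked t s by rewrite linked_sym.
  have e1 := rs_f_braid v lts; have e2 := rs_f_braid (act t v) lst.
  have e3 := rs_f_self t v.
  have [x hx] := reach_total (act s (act t v)).
  have hx' : reach (act t v) (T s *: x) by apply: reach_down; first lia.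
  rewrite (proj1 (IH t ft) z _ vz hx').
  (* At this point, two steps below [v], the pairing with [t] equals [f s v], which is 0. The braid
     relation then carries the eigenvalue [c] from [T t] at [x] to [T s] at [v]. *)
  have fx : T t *: x = c%:A *: x by apply: IH2 hx _; lia.
  rewrite [T s *: _]scalerA [LHS]scalerA hecke_T_braid // -[LHS]scalerA fx.
  by rewrite !scalerA mulr_algr mulr_algl ?scalerAl.
Qed.

End Reach.

(** * Comparison of the induced module with the functions on the reflection set *)

Section Induced.
Variables (A : comNzRingType) (n : nat) (q c : A) (X : reflection_set n) (v0 : X).
Hypothesis c_root : c * c = (q - 1) * c + q.
Hypothesis v0_max : forall v : X, v != v0 -> exists s, rs_f s v < 0.
Hypothesis v0_dom : forall s, 0 <= rs_f s v0.
Variable J : {set dgen n}.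
Hypothesis v0_stab : forall s, (rs_f s v0 == 0) = (s \in J).
Local Notation act := (@rs_act n X).
Local Notation f := (@rs_f n X).
Local Notation T := (hecke_T q).
Local Notation H := (hecke n q).
Local Notation I := (induced (@parabolic_subalg A n q J)
  (fun (u : H) (a : A) => hecke_eval c u * a)).
Local Notation hmod := (@hecke_mod A n q c X).

Definition single (v : X) : X -> A := fun u => (u == v)%:R.

(** The term [TPure h a] goes to [h] applied to [a] times the indicator of [v0]; [teq_mod] lets this
    descend to the tensor product. *)
Fixpoint tterm_mod (x : tterm H A) : X -> A :=
  match x with
  | TPure h a => hmod h (fun u => a * single v0 u)
  | TZero => fun=> 0
  | TOpp x => fun u => - tterm_mod x u
  | TAdd x y => fun u => tterm_mod x u + tterm_mod y u
  end.

Lemma hecke_modZ (h : H) a (g : X -> A) :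
  hmod h (fun v => a * g v) = fun v => a * hmod h g v.
Proof. exact: hterm_modZ. Qed.

Lemma hecke_modD (h : H) (g g' : X -> A) :
  hmod h (fun v => g v + g' v) = fun v => hmod h g v + hmod h g' v.
Proof. exact: hterm_modD. Qed.

(** A generator in [J] fixes [v0], so it multiplies the indicator of [v0] by [c]; sums and products
    follow. This is what the balancing relation of the tensor product requires. *)
Lemma parabolic_mod (u : H) : parabolic_subalg J u ->
  hmod u (single v0) = fun v => hecke_eval c u * single v0 v.
Proof.
elim=> [s sJ|a|x y _ IHx _ IHy|x y _ IHx _ IHy].
- rewrite hecke_mod_T // /hecke_T hecke_eval_pi //=; apply/funext => v.
  have f0 : f s v0 = 0 by apply/eqP; rewrite v0_stab.
  rewrite /mod_T /single; have [->|vv0] := eqVneq v v0; first by rewrite f0 eqxx.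
  have -> : (act s v == v0) = false.
    by rewrite -(rs_act_fix f0) (can_eq (rs_actK s)); apply/negbTE.
  by rewrite mulr0n; case: ifP => _; [|case: ifP => _]; ring.
- by rewrite hecke_mod_cst // hecke_eval_cst.
- by rewrite hecke_mod_add // IHx IHy hecke_evalD //; apply/funext => v; ring.
- rewrite hecke_mod_mul // IHy hecke_modZ IHx hecke_evalM //.
  by apply/funext => v; ring.
Qed.

Lemma teq_mod x y : teq (parabolic_subalg J) (fun (u : H) a => hecke_eval c u * a) x y ->
  tterm_mod x = tterm_mod y.
Proof.
elim=> //=.
- by move=> ? ? ? _ -> _ ->.
- by move=> ? ? _ ->.
- by move=> ? ? ? ? _ -> _ ->.
- by move=> ? ? ?; apply/funext => v; ring.
- by move=> ? ?; apply/funext => v; ring.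
- by move=> ?; apply/funext => v; ring.
- by move=> ?; apply/funext => v; ring.
- by move=> h h' a; rewrite hecke_mod_add.
- by move=> h a b; rewrite -hecke_modD; congr hmod; apply/funext => v; ring.
- move=> h u a Bu; rewrite hecke_mod_mul // (hecke_modZ u) parabolic_mod //.
  by congr hmod; apply/funext => v; ring.
Qed.

Definition induced_mod (x : I) : X -> A := tterm_mod (trepr x).

Lemma induced_mod_pi x : induced_mod (tpi _ _ x) = tterm_mod x.
Proof. exact/teq_mod/trepr_pi. Qed.

Lemma induced_modD (x y : I) :
  induced_mod (x + y) = fun v => induced_mod x v + induced_mod y v.
Proof. by rewrite -[x]treprK -[y]treprK -tpi_add !induced_mod_pi. Qed.

Lemma induced_modZ (h : H) (x : I) : induced_mod (h *: x) = hmod h (induced_mod x).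
Proof.
have hmod0 : hmod h (fun=> 0) = fun=> 0 by exact: hterm_mod0.
rewrite -[x]treprK [h *: _]tact_pi !induced_mod_pi.
elim: (trepr x) => [h' a||y IHy|y IHy z IHz] /=.
- by rewrite hecke_mod_mul.
- by rewrite hmod0.
- rewrite IHy (_ : (fun u => - tterm_mod y u) = fun u => -1 * tterm_mod y u).
    by rewrite hecke_modZ; apply/funext => v; rewrite mulN1r.
  by apply/funext => v; rewrite mulN1r.
- by rewrite IHy IHz hecke_modD.
Qed.

Lemma induced_mod_cst (a : A) (x : I) :
  induced_mod (a%:A *: x) = fun v => a * induced_mod x v.
Proof. by rewrite induced_modZ hecke_mod_cst. Qed.

Lemma induced_mod_sum m (F : 'I_m -> I) v :
  induced_mod (\sum_i F i) v = \sum_i induced_mod (F i) v.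
Proof.
elim/big_ind2: _ => //; first by rewrite -[0 : I]/(tpi _ _ (TZero _ _)) induced_mod_pi.
by move=> x1 x2 y1 y2 <- <-; rewrite induced_modD.
Qed.

Definition induced1 : I := tpi _ _ (TPure 1 1).

(** Scalars belong to the parabolic subalgebra, so they cross the tensor sign. Hence [induced1]
    generates the module. *)
Lemma induced_pure (h : H) (a : A) : tpi _ _ (TPure h a) = (h * a%:A) *: induced1 :> I.
Proof.
rewrite /induced1 [_ *: _]tact_pi /= mulr1; apply/tpiP/teq_sym.
apply: (@teq_trans _ _ _ _ _ (TPure h (hecke_eval c (a%:A : H) * 1))).
  by apply: teq_bal; apply: psub_cst.
by rewrite hecke_eval_cst // mulr1; apply: teq_refl.
Qed.

Lemma induced1_fix s : f s v0 = 0 -> T s *: induced1 = c%:A *: induced1.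
Proof.
move=> /eqP; rewrite v0_stab => sJ.
rewrite -[c%:A]mul1r -induced_pure /induced1 [LHS]tact_pi /= mulr1 -[T s]mul1r.
apply/tpiP; apply: (@teq_trans _ _ _ _ _ (TPure 1 (hecke_eval c (T s) * 1))).
  by apply: teq_bal; apply: psub_gen.
by rewrite hecke_eval_pi // mulr1; apply: teq_refl.
Qed.

(** On an ascending step [T s] sends the indicator of [u] exactly to that of [act s u]. The images
    of the lifted elements are thus visibly independent. *)
Lemma reach_mod v (y : I) : reach v0 induced1 v y -> induced_mod y = single v.
Proof.
elim=> [|s u z _ IH fs].
  rewrite induced_mod_pi /= hecke_mod1 //.
  by apply/funext => u; rewrite mul1r.
rewrite induced_modZ IH hecke_mod_T //; apply/funext => w; rewrite /single.
have [->|wu] := eqVneq w (act s u).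
  have fu : f s (act s u) < 0 by rewrite rs_f_self oppr_lt0.
  rewrite mod_T_lt0 // rs_actK eqxx; case: eqVneq => [e|_]; last by rewrite mulr0 addr0.
  by move: fu; rewrite e ltNge ltW.
have swu : (act s w == u) = false.
  by apply: contraNF wu => /eqP <-; rewrite rs_actK.
have [wu'|/negPf wu'] := eqVneq w u; last first.
  by rewrite /mod_T /= swu wu' mulr0n; case: ifP => _; [|case: ifP => _]; ring.
by rewrite mod_T_gt0 ?swu ?mulr0 // wu'.
Qed.

(** The default value 0 is never taken, by [reach_total]. *)
Definition induced_basis (v : X) : I := xget 0 [set y | reach v0 induced1 v y]%classic.

Lemma induced_basisP v : reach v0 induced1 v (induced_basis v).
Proof.
rewrite /induced_basis; case: xgetP => // h.
by have [y /h] := reach_total v0_max induced1 v.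
Qed.

Lemma induced_basis_mod v : induced_mod (induced_basis v) = single v.
Proof. exact/reach_mod/induced_basisP. Qed.

(** The span contains the generator [induced1] and is stable under each [T s], hence under the whole
    algebra. *)
Lemma induced_basis_span (x : I) :
  exists cf : X -> A, x = \sum_v (cf v)%:A *: induced_basis v.
Proof.
pose S (z : I) := exists cf : X -> A, z = \sum_v (cf v)%:A *: induced_basis v.
have SD y z : S y -> S z -> S (y + z).
  move=> [cf ->] [cg ->]; exists (fun v => cf v + cg v).
  by rewrite -big_split; apply: eq_bigr => v _; rewrite !scalerDl.
have SZ (a : A) z : S z -> S (a%:A *: z).
  move=> [cf ->]; exists (fun v => a * cf v).
  by rewrite scaler_sumr; apply: eq_bigr => v _; rewrite scalerA mulr_algl scalerA.
have S0 : S 0.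
  by exists (fun=> 0); rewrite big1 // => v _; rewrite !scale0r.
have Sb v : S (induced_basis v).
  exists (single v); rewrite (bigD1 v) //= big1 => [|u /negPf uv].
    by rewrite /single eqxx !scale1r addr0.
  by rewrite /single uv !scale0r.
have S_sum (F : X -> I) : (forall v, S (F v)) -> S (\sum_v F v).
  by move=> hF; elim/big_ind: _.
have ST s z : S z -> S (T s *: z).
  move=> [cf ->]; rewrite scaler_sumr; apply: S_sum => v.
  rewrite scalerA mulr_algr -[_ *: T s]mulr_algl -scalerA; apply: (SZ).
  have up u : 0 < f s u -> T s *: induced_basis u = induced_basis (act s u).
    move=> fu; apply: (proj1 (reach_spec v0_max v0_dom induced1_fix (act s u))).
      exact: reachS (induced_basisP u) fu.
    exact: induced_basisP.
  have [h|h|h] := ltgtP (f s v) 0.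
  (* At a descent the basis element is [T s] times the one at [act s v], and the quadratic relation
     expands [T s * T s]. *)
  - have fv : 0 < f s (act s v) by rewrite rs_f_self oppr_gt0.
    have := up _ fv; rewrite rs_actK => <-.
    rewrite scalerA hecke_T_quad scalerDl -[_ *: T s]mulr_algl -scalerA up // rs_actK.
    exact: SD (SZ _ _ (Sb _)) (SZ _ _ (Sb _)).
  - by rewrite up.
  - rewrite (proj2 (reach_spec v0_max v0_dom induced1_fix v) s _ (induced_basisP v) h).
    exact: SZ (Sb _).
have SH (h : H) z : S z -> S (h *: z).
  elim/hecke_ind: h z => [s|a|h h' Sh Sh'|h h' Sh Sh'] z Sz.
  - exact: ST.
  - exact: SZ.
  - by rewrite scalerDl; apply: SD; auto.
  - by rewrite -scalerA; auto.
have S1 : S induced1.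
  have r0 : reach v0 induced1 v0 induced1 by constructor.
  rewrite (proj1 (reach_spec v0_max v0_dom induced1_fix v0) _ _ r0 (induced_basisP v0)).
  exact: Sb.
rewrite -[x]treprK; elim: (trepr x) => [h a||y Sy|y Sy z Sz].
- by rewrite induced_pure; apply: SH.
- exact: S0.
- rewrite tpi_opp -scaleN1r -[-1](scaleN1r (1 : H)); exact: SZ.
- by rewrite tpi_add; apply: SD.
Qed.

(** [induced_mod] turns the spanning family into indicator functions, so evaluation at [v] reads off
    the coordinate at [v]. *)
Lemma induced_expand (x : I) : x = \sum_v (induced_mod x v)%:A *: induced_basis v.
Proof.
have [cf e] := induced_basis_span x; rewrite {1}e; apply: eq_bigr => v _.
suff -> : induced_mod x v = cf v by [].
rewrite e; have sumE (r : seq X) (F : X -> I) :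
    induced_mod (\sum_(u <- r) F u) v = \sum_(u <- r) induced_mod (F u) v.
  elim/big_ind2: _ => //; first by rewrite -[0 : I]/(tpi _ _ (TZero _ _)) induced_mod_pi.
  by move=> x1 x2 y1 y2 <- <-; rewrite induced_modD.
rewrite sumE (bigD1 v) //= big1 => [|u uv].
  by rewrite induced_mod_cst induced_basis_mod /single eqxx mulr1 addr0.
by rewrite induced_mod_cst induced_basis_mod /single eq_sym (negPf uv) mulr0.
Qed.

Lemma induced_trace (h : H) : is_trace I h (\sum_v hmod h (single v) v).
Proof.
pose e (i : 'I_#|X|) : X := enum_val i.
have sumE (V : zmodType) (F : X -> V) : \sum_v F v = \sum_i F (e i).
  by rewrite (reindex e) //; apply: onW_bij; apply: enum_val_bij.
exists #|X|, (fun i => induced_basis (e i)),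
  (\matrix_(i, j) hmod h (single (e j)) (e i)); split.
- move=> x; exists (\row_i induced_mod x (e i)); split.
    rewrite [LHS]induced_expand sumE; apply: eq_bigr => i _; by rewrite mxE.
  move=> cf ->; apply/rowP => i; rewrite mxE induced_mod_sum (bigD1 i) //=.
  rewrite big1 => [|j ji].
    by rewrite induced_mod_cst induced_basis_mod /single eqxx mulr1 addr0.
  rewrite induced_mod_cst induced_basis_mod /single.
  by rewrite (inj_eq enum_val_inj) eq_sym (negPf ji) mulr0.
- move=> j; rewrite [LHS]induced_expand sumE; apply: eq_bigr => i _.
  by rewrite mxE induced_modZ induced_basis_mod.
- by rewrite sumE; apply: eq_bigr => i _; rewrite mxE.
Qed.

Lemma induced_char_Tword (r : seq (dgen n)) : uniq r ->
  char_of I (hecke_Tword q r) = \sum_(v : X) \prod_(s <- r) diag_coef q c s v.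
Proof.
move=> ur; rewrite (char_ofE (induced_trace _)); apply: eq_bigr => v _.
by rewrite hecke_mod_Tword // trace_Tword.
Qed.

End Induced.

(** * Orbits of integer vectors under D_n *)

Section Vectors.
Variable n : nat.
Local Notation vec := {ffun 'I_n.+2 -> int}.
Implicit Types (s t : dgen n) (u v w : vec).

Definition root_vec s : vec :=
  match s with
  | None => [ffun j => (j == pos1)%:R + (j == pos2)%:R]
  | Some i => [ffun j => (j == pos_r i)%:R - (j == pos_l i)%:R]
  end.

Definition dotr s v : int :=
  match s with
  | None => v pos1 + v pos2
  | Some i => v (pos_r i) - v (pos_l i)
  end.

Definition refl s v : vec := [ffun j => v j - dotr s v * root_vec s j].

(** The fundamental coweights, doubled for [t] and [s_1] to clear the halves. Only the positivity of
    the pairing with the own root matters. *)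
Definition coweight s : vec :=
  match s with
  | None => [ffun=> 1]
  | Some i => [ffun j : 'I_n.+2 => if (i < j)%N then 1 else - (val i == 0%N)%:R]
  end.

Definition dotw s v : int := \sum_j coweight s j * v j.

Lemma pos_lE (i : 'I_n.+1) : pos_l i = i :> nat. Proof. by []. Qed.
Lemma pos_rE (i : 'I_n.+1) : pos_r i = i.+1 :> nat. Proof. by []. Qed.
Lemma pos2E : @pos2 n = 1%N :> nat. Proof. by []. Qed.
Definition posE := (pos_lE, pos_rE, pos2E).

Lemma dotr_root s t : dotr t (root_vec s) =
  if s == t then 2 else - (linked s t)%:R.
Proof.
have natE (a b : 'I_n.+2) : (a == b) = (a == b :> nat) by [].
case: s t => [i|] [j|]; rewrite /dotr /root_vec !ffunE !natE ?posE /=.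
- rewrite (_ : (Some i == Some j) = (i == j :> nat)) //.
  by do ?[case: eqP => /= ?]; lia.
- by do ?[case: eqP => /= ?]; lia.
- by do ?[case: eqP => /= ?]; lia.
- by [].
Qed.

Lemma dotr_refl s t v :
  dotr t (refl s v) = dotr t v - dotr s v * dotr t (root_vec s).
Proof. by case: t => [i|]; rewrite /= !ffunE; ring. Qed.

Lemma dotr_coweight s t : s != t -> dotr t (coweight s) = 0.
Proof.
have natE (a b : 'I_n.+2) : (a == b) = (a == b :> nat) by [].
case: s t => [i|] [j|] //; rewrite /dotr !ffunE ?posE //.
  rewrite (_ : (Some i == Some j) = (i == j :> nat)) //=; move=> /eqP ij.
  by do ?[case: eqP => /= ?]; do ?[case: ltnP => /= ?]; lia.
by move=> _ /=; do ?[case: eqP => /= ?]; do ?[case: ltnP => /= ?]; lia.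
Qed.

Lemma dotr_coweight_gt0 s : 0 < dotr s (coweight s).
Proof.
case: s => [i|]; rewrite /dotr !ffunE ?posE //=.
by rewrite ltnSn ltnn; case: eqP.
Qed.

Lemma sum_root s u : \sum_j u j * root_vec s j = dotr s u.
Proof.
have delta (a : 'I_n.+2) : \sum_j u j * (j == a)%:R = u a.
  by rewrite (bigD1 a) //= eqxx mulr1 big1 ?addr0 // => j /negPf->; rewrite mulr0.
case: s => [i|] /=; under eq_bigr => j _ do rewrite ffunE ?mulrDr ?mulrN.
  by rewrite sumrB !delta.
by rewrite big_split /= !delta.
Qed.

Lemma dotw_refl s t v :
  dotw s (refl t v) = dotw s v - dotr t v * dotr t (coweight s).
Proof.
rewrite -(sum_root t (coweight s)) mulr_sumr -sumrB.
by apply: eq_bigr => j _; rewrite ffunE; ring.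
Qed.

Lemma reflK s : involutive (refl s).
Proof.
move=> v; apply/ffunP => j; rewrite ffunE dotr_refl dotr_root eqxx ffunE; ring.
Qed.

Lemma refl_fix s v : dotr s v = 0 -> refl s v = v.
Proof. by move=> h; apply/ffunP => j; rewrite ffunE h; ring. Qed.

Lemma refl_comm s t v : s != t -> ~~ linked s t ->
  refl s (refl t v) = refl t (refl s v).
Proof.
move=> st lst; apply/ffunP => j; rewrite !ffunE !dotr_refl !dotr_root.
rewrite (eq_sym t) (negPf st) (linked_sym t) (negPf lst) mulr0n; ring.
Qed.

Lemma refl_braid s t v : linked s t ->
  refl s (refl t (refl s v)) = refl t (refl s (refl t v)).
Proof.
move=> lst; have st := linked_neq lst; apply/ffunP => j.
rewrite !ffunE !dotr_refl !dotr_root !eqxx.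
rewrite (eq_sym t) (negPf st) (linked_sym t) lst mulr1n; ring.
Qed.

Definition refl_pos s : {perm 'I_n.+2} :=
  match s with
  | None => tperm pos1 pos2
  | Some i => tperm (pos_l i) (pos_r i)
  end.

Definition refl_flip s (j : 'I_n.+2) : bool :=
  (s == None) && ((j == pos1) || (j == pos2)).

Lemma pos_lr (i : 'I_n.+1) : (pos_l i == pos_r i) = false.
Proof. by apply/negbTE/eqP => /(congr1 (@nat_of_ord _)); rewrite !posE; lia. Qed.

Lemma reflE s v j : refl s v j = (-1) ^+ refl_flip s j * v (refl_pos s j).
Proof.
rewrite ffunE; case: s => [i|] /=; rewrite !ffunE /refl_flip /= ?expr0 ?mul1r.
  case: tpermP => [->|->|/eqP/negPf-> /eqP/negPf->]; last by ring.
    by rewrite eqxx pos_lr /=; ring.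
  by rewrite eqxx eq_sym pos_lr /=; ring.
case: tpermP => [->|->|/eqP/negPf-> /eqP/negPf->]; rewrite ?eqxx /=; last by ring.
  by rewrite expr1 addr0; ring.
by rewrite expr1 add0r; ring.
Qed.

Lemma dgen_permE s j b :
  dgen_perm s (j, b) = (refl_pos s j, refl_flip s j (+) b).
Proof.
have tpermE (T : finType) (x y z : T) :
    tperm x y z = if z == x then y else if z == y then x else z.
  by case: tpermP => [->|->|/eqP/negPf-> /eqP/negPf->//]; rewrite eqxx //; case: eqP.
case: s => [i|]; rewrite /refl_flip /= permM !tpermE.
  have lr := pos_lr i; have rl := lr; rewrite eq_sym in rl.
  case: (eqVneq j (pos_l i)) => [->|/negPf jl].
    by case: b; do 3 rewrite ?(xpair_eqE, eqxx, lr, rl, andbF) /=.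
  case: (eqVneq j (pos_r i)) => [->|/negPf jr].
    by case: b; do 3 rewrite ?(xpair_eqE, eqxx, lr, rl, andbF) /=.
  by do 3 rewrite ?(xpair_eqE, jl, jr) /=.
case: (eqVneq j pos1) => [->|/negPf jl].
  by case: b; do 3 rewrite ?(xpair_eqE, eqxx, andbF) /=.
case: (eqVneq j pos2) => [->|/negPf jr].
  by case: b; do 3 rewrite ?(xpair_eqE, eqxx, andbF) /=.
by do 3 rewrite ?(xpair_eqE, jl, jr) /=.
Qed.

(** The odd extension of [v] to the signed indices. *)
Definition signed_val v (x : signed n.+2) : int := (-1) ^+ x.2 * v x.1.

Lemma signed_val_refl s v x : signed_val (refl s v) x = signed_val v (dgen_perm s x).
Proof.
case: x => j b; rewrite dgen_permE /signed_val /= reflE signr_addb.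
by rewrite mulrA; congr (_ * _); apply: mulrC.
Qed.

(** A reflection acts on odd extensions by precomposition with its signed permutation, so a word
    acts on vectors only through its product. *)
Lemma word_perm_refl (r r' : seq (dgen n)) v : word_perm r = word_perm r' ->
  foldr refl v r = foldr refl v r'.
Proof.
have E (l : seq (dgen n)) x :
    signed_val (foldr refl v l) (word_perm l x) = signed_val v x.
  rewrite /word_perm; elim: l x => [|s l IHl] x /=; first by rewrite big_nil perm1.
  by rewrite rev_cons -cats1 big_cat big_seq1 permM -signed_val_refl reflK IHl.
move=> e; apply/ffunP => j.
have := E r (((word_perm r)^-1)%g (j, false)).
have := E r' (((word_perm r)^-1)%g (j, false)).
by rewrite e permKV /signed_val /= !mul1r => -> ->.
Qed.

(** The Weyl vector of [D_n] in these coordinates. *)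
Definition rho_vec : vec := [ffun j : 'I_n.+2 => (j : nat)%:Z].

Lemma dotr_rho s : dotr s rho_vec = 1.
Proof. by case: s => [i|]; rewrite /= !ffunE !posE //; lia. Qed.

Lemma dotw_word s (r : seq (dgen n)) v : s \notin r -> dotw s (foldr refl v r) = dotw s v.
Proof.
elim: r => //= t r IHr; rewrite inE negb_or => /andP[st /IHr<-].
by rewrite dotw_refl dotr_coweight // mulr0 subr0.
Qed.

(** A generator of [K] missing from [r] would leave its coweight pairing unchanged under [r], while
    the word [rK] changes it for a suitable vector. So [r] contains all of [K], and by minimality it
    is no longer than [rK]. *)
Lemma reduced_perm_enum (K : {set dgen n}) (g : {perm signed n.+2}) (r : seq (dgen n)) :
  parabolic_of_type K g -> reduced_expr g r -> perm_eq r (enum K).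
Proof.
move=> [rK rKK rKw] [rw rmin].
have uK : uniq rK by rewrite (perm_uniq rKK) enum_uniq.
have sub : {subset rK <= r}.
  move=> s srK; apply/negPn/negP => sr.
  have W v : foldr refl v rK = foldr refl v r by apply: word_perm_refl; rewrite rKw.
  case/splitPr: srK uK W => r1 r2; rewrite cat_uniq /= negb_or -!andbA.
  (* The test vector is chosen so that [r2] brings it to [rho_vec], which [s] then really moves. *)
  move=> /and5P[_ s1 _ s2 _] /(_ (foldr refl rho_vec (rev r2)))/(congr1 (dotw s)).
  rewrite foldr_cat /= (dotw_word _ s1) dotw_refl (dotw_word _ sr).
  have -> : foldr refl (foldr refl rho_vec (rev r2)) r2 = rho_vec.
    rewrite -foldr_cat; elim/last_ind: (r2) => //= l t IHl.
    by rewrite rev_rcons -cats1 -catA foldr_cat /= reflK -foldr_cat IHl.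
  rewrite (@dotw_word _ (rev r2)) ?mem_rev // dotr_rho mul1r.
  by have := dotr_coweight_gt0 s; lia.
apply: perm_trans rKK; rewrite perm_sym.
have rle := rmin _ rKw; have [_ e] := uniq_min_size uK sub rle.
by apply: uniq_perm => //; apply: leq_size_uniq rle.
Qed.

End Vectors.

(** * The orbit of a vector as a finite reflection set *)

Section Orbit.
Variables (n : nat) (v0 : {ffun 'I_n.+2 -> int}).
Local Notation vec := {ffun 'I_n.+2 -> int}.

Definition abs_seq (v : vec) : seq nat := [seq `|v j|%N | j <- enum 'I_n.+2].

(** Given the absolute values, the product records the parity of the number of negative entries if
    no entry is 0, and imposes nothing otherwise. *)
Definition in_orbit (v : vec) : bool :=
  perm_eq (abs_seq v) (abs_seq v0) && (\prod_j v j == \prod_j v0 j).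

Definition orbit_bound : nat := \sum_(m <- abs_seq v0) m.

(** The orbit lies in the box of vectors with entries between [-orbit_bound] and [orbit_bound]; the
    ordinals are shifted by [orbit_bound] to run through it. *)
Definition orbit_enum : seq vec :=
  [seq v <- [seq [ffun j => (g j : nat)%:Z - orbit_bound%:Z]
            | g : {ffun 'I_n.+2 -> 'I_(orbit_bound.*2).+1}] | in_orbit v].

Lemma mem_orbit_enum v : (v \in orbit_enum) = in_orbit v.
Proof.
rewrite mem_filter andb_idr // => /andP[/perm_mem vv0 _].
have vle j : (`|v j| <= orbit_bound)%N.
  have : `|v j|%N \in abs_seq v0 by rewrite -vv0; apply: map_f; rewrite mem_enum.
  by move=> h; rewrite /orbit_bound (big_rem _ h) /= leq_addr.
apply/mapP; exists [ffun j => inord (absz (v j + orbit_bound%:Z))].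
  by rewrite mem_enum.
by apply/ffunP => j; rewrite !ffunE inordK; have := vle j; lia.
Qed.

Lemma refl_orbit s v : in_orbit v -> in_orbit (refl s v).
Proof.
move=> /andP[pv dv]; apply/andP; split.
  apply: perm_trans pv; rewrite /abs_seq.
  rewrite (eq_map (g := (fun j => `|v j|%N) \o refl_pos s)); last first.
    by move=> j /=; rewrite reflE abszM abszX exp1n mul1n.
  rewrite map_comp; apply: perm_map; apply: uniq_perm; rewrite ?enum_uniq //.
    by rewrite map_inj_uniq ?enum_uniq //; apply: perm_inj.
  move=> j; rewrite mem_enum; apply/mapP; exists ((refl_pos s)^-1 j)%g.
    by rewrite mem_enum.
  by rewrite permKV.
rewrite -(eqP dv) (eq_bigr _ (fun j _ => reflE s v j)) big_split /=.
have -> : \prod_j v (refl_pos s j) = \prod_j v j.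
  by rewrite [RHS](reindex_inj (@perm_inj _ (refl_pos s))).
(* The generator [t] flips two signs, the others none. *)
suff -> : \prod_j (-1) ^+ refl_flip s j = 1 :> int by rewrite mul1r.
case: s => [i|]; first by rewrite big1.
by rewrite !big_ord_recl big1 //= => j _.
Qed.

Definition orbit_point := seq_sub orbit_enum.

Definition orbit_val (x : orbit_point) : vec := ssval x.

Lemma orbit_valP x : in_orbit (orbit_val x).
Proof. by rewrite -mem_orbit_enum; apply: ssvalP. Qed.

Definition orbit_mk v (h : in_orbit v) : orbit_point :=
  SeqSub (etrans (mem_orbit_enum v) h).

Definition orbit_act s (x : orbit_point) : orbit_point :=
  orbit_mk (refl_orbit s (orbit_valP x)).

Lemma orbit_val_inj : injective orbit_val.
Proof. exact: val_inj. Qed.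

Lemma orbit_actE s x : orbit_val (orbit_act s x) = refl s (orbit_val x).
Proof. by []. Qed.

Definition orbit_rs : reflection_set n.
Proof.
refine (@ReflectionSet n orbit_point orbit_act
  (fun s x => dotr s (orbit_val x)) (fun s x => dotw s (orbit_val x))
  _ _ _ _ _ _ _ _ _).
- by move=> s x; apply: orbit_val_inj; rewrite !orbit_actE reflK.
- by move=> s x h; apply: orbit_val_inj; rewrite orbit_actE refl_fix.
- by move=> s t x st lst; apply: orbit_val_inj; rewrite !orbit_actE refl_comm.
- by move=> s t x lst; apply: orbit_val_inj; rewrite !orbit_actE refl_braid.
- by move=> s x; rewrite orbit_actE dotr_refl dotr_root eqxx; ring.
- move=> s t x st lst; rewrite orbit_actE dotr_refl dotr_root (negPf st).
  by rewrite (negPf lst) mulr0n; ring.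
- move=> s t x lst; rewrite orbit_actE dotr_refl dotr_root.
  by rewrite (negPf (linked_neq lst)) lst mulr1n; ring.
- by move=> s t x st; rewrite orbit_actE dotw_refl dotr_coweight // mulr0 subr0.
- move=> s x h; rewrite orbit_actE dotw_refl.
  by have := dotr_coweight_gt0 s; nia.
Defined.

(** The pairings with [s_1] and [t] bound the absolute value of the first entry by the second entry;
    the remaining ones make the later entries weakly increasing. *)
Lemma dominant_abs v : (forall s, 0 <= dotr s v) ->
  forall j k : 'I_n.+2, (j <= k)%N -> (`|v j| <= `|v k|)%N /\ ((0 < k)%N -> 0 <= v k).
Proof.
move=> dom.
have step i : v (pos_l i) <= v (pos_r i) by have := dom (Some i); rewrite /= subr_ge0.
have v2 : `|v pos1| <= v pos2.
  have := step ord0; have := dom None; rewrite /= (_ : pos_l ord0 = pos1); last exact: val_inj.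
  by rewrite (_ : pos_r ord0 = pos2) //; lia.
have up (k : 'I_n.+2) : forall j : 'I_n.+2, (0 < j)%N -> (j <= k)%N -> v j <= v k.
  case: k => k; elim: k => [|k IHk] hk j j0 /=; first by lia.
  rewrite leq_eqVlt => /predU1P[jk|jk]; first by rewrite (_ : j = Ordinal hk) //; apply: val_inj.
  have hk' : (k < n.+2)%N by lia.
  apply: le_trans (IHk hk' j j0 jk) _.
  have hk'' : (k < n.+1)%N by lia.
  have := step (Ordinal hk''); congr (v _ <= v _); exact: val_inj.
have up2 (k : 'I_n.+2) : (0 < k)%N -> `|v pos1| <= v k.
  by move=> k0; apply: le_trans v2 (up _ _ _ _); rewrite ?posE.
move=> j k jk; split=> [|k0]; last by apply: le_trans (up2 k k0); apply: normr_ge0.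
have [j0|j0] := posnP j.
  rewrite (_ : j = pos1); last exact: val_inj.
  have [k0|k0] := posnP k; first by rewrite (_ : k = pos1) //; apply: val_inj.
  by have := up2 k k0; lia.
have := up2 j j0; have := up k j j0 jk; lia.
Qed.

(** Both sequences of absolute values are sorted, hence equal. Beyond the first position the entries
    are nonnegative, so only the sign of the first one remains. *)
Lemma dominant_unique v : (forall s, 0 <= dotr s v0) -> 0 <= v0 pos1 ->
  (forall s, 0 <= dotr s v) -> in_orbit v -> v = v0.
Proof.
move=> dom0 v00 dom /andP[pv /eqP dv].
have sorted_abs u : (forall s, 0 <= dotr s u) -> sorted leq (abs_seq u).
  move=> domu; apply: (homo_sorted_in (P := predT) (e := fun i j : 'I_n.+2 => (i <= j)%N)).
  - by move=> i j _ _ ij; case: (dominant_abs domu ij).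
  - by apply/allP.
  - have := iota_sorted 0 n.+2; rewrite -val_enum_ord sorted_map; exact.
have abs j : `|v j|%N = `|v0 j|%N.
  have e : abs_seq v = abs_seq v0.
    by apply: (sorted_eq leq_trans anti_leq); rewrite ?sorted_abs.
  by have /eq_in_map -> := e; rewrite ?mem_enum.
have rest j : j != pos1 -> v j = v0 j.
  move=> j1; have j0 : (0 < j)%N by rewrite lt0n; apply: contraNneq j1 => e; apply/eqP/val_inj.
  have [_ /(_ j0) a] := dominant_abs dom (leqnn j).
  have [_ /(_ j0) b] := dominant_abs dom0 (leqnn j).
  by have := abs j; lia.
apply/ffunP => j; have [->|/rest//] := eqVneq j pos1.
move: dv; rewrite (bigD1 pos1) //= [RHS](bigD1 pos1) //=.
rewrite (eq_bigr v0) => [|k]; last exact: rest.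
(* Unless another entry is 0, the rest of the product cancels. If one is 0, dominance forces the
   first entry to be 0. *)
have [|nz] := eqVneq (\prod_(i | i != pos1) v0 i) 0; last by move/(mulIf nz).
move/eqP/prodf_eq0 => [k _ /eqP k0] _.
have [h _] := dominant_abs dom0 (leq0n k : (@pos1 n <= k)%N).
by have := abs pos1; lia.
Qed.

End Orbit.

(** * Orbit points and admissible sequences *)

Lemma count_map_enum (T : finType) (f : T -> nat) m :
  count_mem m [seq f j | j <- enum T] = #|[set j | f j == m]|.
Proof.
by rewrite count_map cardsE cardE -size_filter enumT; congr size; apply: eq_filter.
Qed.

Lemma prod_sign (T : finType) (a : T -> int) :
  \prod_j a j = (-1) ^+ #|[set j | a j < 0]| * \prod_j `|a j|.
Proof.
rewrite (eq_bigr _ (fun j _ => realEsign (num_real (a j)))) big_split /=.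
congr (_ * _); rewrite -expr_sum; congr (_ ^+ _).
by rewrite -sum1_card [RHS]big_mkcond; apply: eq_bigr => j _; rewrite inE; case: ltP.
Qed.

(** * A dominant vector for [J] *)

Section Base.
Variables (n : nat) (J : {set dgen n}).
Hypothesis hJ : ~ (gs ord0 \notin J /\ gt \in J).
Local Notation vec := {ffun 'I_n.+2 -> int}.

Lemma bars_before_r i :
  bars_before J (pos_r i) = (bars_before J (pos_l i) + (gs i \notin J))%N.
Proof.
rewrite /bars_before posE.
rewrite (cardsD1 i) inE posE ltnSn /= addnC; congr (_ + _)%N.
apply: eq_card => j; rewrite !inE ltnS leq_eqVlt -val_eqE /=.
by case: ltngtP.
Qed.

Lemma bars_before0 : bars_before J pos1 = 0%N.
Proof. by apply: eq_card0 => j; rewrite inE. Qed.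

Lemma bars_before_le i : (bars_before J i <= #|[set j : 'I_n.+1 | gs j \notin J]|)%N.
Proof. by apply/subset_leq_card/fintype.subsetP => j; rewrite !inE => /andP[]. Qed.

(** Constant on the blocks of the composition. The first block has value 0 when [t] is in [J], so
    that sign changes there are invisible, and value 1 otherwise. *)
Definition base_vec : vec := [ffun i => (bars_before J i + (gt \notin J))%N%:Z].

Lemma dotr_base s :
  if s \in J then dotr s base_vec = 0 else 0 < dotr s base_vec.
Proof.
case: s => [i|]; rewrite /= !ffunE.
  by rewrite bars_before_r -/(gs i); case: (gs i \in J) => /=; lia.
have -> : @pos2 n = pos_r ord0 by [].
rewrite bars_before_r (_ : pos_l ord0 = pos1); last exact: val_inj.
(* If [t] is in [J], then so is [s_1] by [hJ], and the first two entries are 0; otherwise both are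
   positive. *)
rewrite bars_before0; move: hJ; rewrite -/gt.
by case: (gt \in J); case: (gs ord0 \in J) => /= h; lia.
Qed.

Lemma dotr_base_ge0 s : 0 <= dotr s base_vec.
Proof. by have := dotr_base s; case: ifP => [_ -> //|_ /ltW]. Qed.

Lemma dotr_base_eq0 s : (dotr s base_vec == 0) = (s \in J).
Proof. by have := dotr_base s; case: ifP => [_ -> //|_ /gt_eqF]. Qed.

Local Notation X := (orbit_rs base_vec).

Definition base_point : X := orbit_mk (introT andP (conj (perm_refl _) (eqxx _))).

(** A point without descents is dominant, so [dominant_unique] applies. *)
Lemma base_point_max (x : X) : x != base_point -> exists s, rs_f s x < 0.
Proof.
apply: contra_neqP => h; apply: orbit_val_inj; apply: dominant_unique.
- exact: dotr_base_ge0.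
- by rewrite ffunE.
- by move=> s; rewrite leNgt; apply/negP => fs; apply: h; exists s.
- exact: orbit_valP.
Qed.

Lemma char_orbit (A : comNzRingType) (q c : A) (r : seq (dgen n)) (K : {set dgen n}) :
  c * c = (q - 1) * c + q -> perm_eq r (enum K) ->
  char_of (induced (parabolic_subalg J) (fun (u : hecke n q) (v : A) => hecke_eval c u * v))
    (hecke_Tword q r) = \sum_(x : X) \prod_(s in K) diag_coef q c s x.
Proof.
move=> c_root rK.
rewrite (induced_char_Tword c_root base_point_max) //.
- apply: eq_bigr => x _; rewrite (perm_big _ rK) /= big_enum /=.
  by apply: eq_bigl => s.
- exact: dotr_base_ge0.
- exact: dotr_base_eq0.
- by rewrite (perm_uniq rK) enum_uniq.
Qed.

End Base.

(** * Normal forms of orbit points *)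

Section Normal.
Variables (n : nat) (J : {set dgen n}).
Local Notation vec := {ffun 'I_n.+2 -> int}.
Implicit Types (a v : vec).

Record shape a : Prop := Shape {
  shape_range : forall i, (1 <= `|a i| <= size (signed_comp J))%N;
  shape_content : forall k, (k < size (signed_comp J))%N ->
    #|[set i | `|a i|%N == k.+1]| = `|nth 0%R (signed_comp J) k|%N;
  shape_even : ~~ odd #|[set i | (a i < 0)%R]|;
  shape_normal : gt \in J -> (#|[set i | (a i == -1)%R]| <= 1)%N /\
    forall i, a i = -1 -> forall j : 'I_n.+2, (j < i)%N -> a j <> 1
}.

(* When t is in J, the entries 1 and -1 of a both stand for the entry 0 of the
   orbit point; the sign of the first of them keeps the parity. *)
Definition flat a : vec := [ffun i => if gt \in J then a i - sgz (a i) else a i].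

Definition first_zero v (i : 'I_n.+2) : bool :=
  (v i == 0) && [forall j : 'I_n.+2, (j < i)%N ==> (v j != 0)].

Definition unflat v : vec := [ffun i =>
  if gt \in J then
    if v i == 0 then
      (-1) ^+ (first_zero v i && odd #|[set j | (v j < 0)%R]|)
    else v i + sgz (v i)
  else v i].

Lemma flatE a i : flat a i = if gt \in J then a i - sgz (a i) else a i.
Proof. by rewrite ffunE. Qed.

Lemma sgz_spec (x : int) : [\/ x = 0 /\ sgz x = 0, 0 < x /\ sgz x = 1%Z | x < 0 /\ sgz x = - 1%Z].
Proof.
by case: (sgzP x) => ?; [constructor 1|constructor 2|constructor 3].
Qed.

Lemma unflatK v : flat (unflat v) = v.
Proof.
apply/ffunP => i; rewrite !ffunE; case: (gt \in J) => //.
have [vi|vi] := eqVneq (v i) 0; first by rewrite vi; case: (_ && _).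
move: (v i) vi => x x0.
case: (sgz_spec x) => -[hx ->]; first by lia.
  by case: (sgz_spec (x + 1%Z)) => -[hx' ->]; lia.
by case: (sgz_spec (x + - 1%Z)) => -[hx' ->]; lia.
Qed.

(** Part [k + 1] of the composition consists of the dots with [k] bars before them. *)
Lemma shape_abs a :
  (forall i, (1 <= `|a i| <= size (signed_comp J))%N) /\
  (forall k, (k < size (signed_comp J))%N ->
    #|[set i | `|a i|%N == k.+1]| = `|nth 0%R (signed_comp J) k|%N) <->
  perm_eq (abs_seq a) [seq (bars_before J i).+1 | i <- enum 'I_n.+2].
Proof.
rewrite size_mkseq; set p := #|[set j | gs j \notin J]|.
have nthE k : (k < p.+1)%N ->
    `|nth 0%R (signed_comp J) k|%N = #|[set i | (bars_before J i).+1 == k.+1]|.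
  by move=> kp; rewrite nth_mkseq //=; case: ifP => _; rewrite ?abszN absz_nat.
have bp i := bars_before_le J i.
split=> [[range cont]|pe].
  apply/allP => m _; apply/eqP; rewrite /abs_seq !count_map_enum.
  have [mp|mp] := boolP (0 < m <= p.+1)%N.
    by case: m mp => // m mp; rewrite cont ?nthE //; lia.
  rewrite !eq_card0 // => i; rewrite inE; apply/negbTE; apply: contraNneq mp => <- //.
  exact: bp.
split=> [i|k kp].
  have : `|a i|%N \in abs_seq a by apply: map_f; rewrite mem_enum.
  by rewrite (perm_mem pe) => /mapP[j _ ->]; rewrite ltnS /=; exact: bp.
by rewrite nthE // -!count_map_enum; have /seq.permP := pe; apply.
Qed.



Lemma flat_abs a i : a i != 0 -> (`|flat a i| + (gt \in J))%N = `|a i|%N.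
Proof.
rewrite flatE; move: (a i) => x x0; case: (gt \in J); last by rewrite addn0.
by case: (sgz_spec x) => -[hx ->]; lia.
Qed.

Lemma flat_eq0 a i : gt \in J -> (flat a i == 0) = [|| a i == 0, a i == 1 | a i == -1].
Proof.
move=> tJ; rewrite flatE tJ; move: (a i) => x.
by case: (sgz_spec x) => -[hx ->]; lia.
Qed.

Lemma orbit_abs a : (forall i, a i != 0) ->
  perm_eq (abs_seq (flat a)) (abs_seq (base_vec J)) =
  perm_eq (abs_seq a) [seq (bars_before J i).+1 | i <- enum 'I_n.+2].
Proof.
move=> a0; have inj : injective (fun m => m + (gt \in J))%N by move=> x y /addIn.
have map_perm (s s' : seq nat) :
    perm_eq (map (fun m => m + (gt \in J))%N s) (map (fun m => m + (gt \in J))%N s') = perm_eq s s'.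
  by apply/idP/idP => [/(perm_map_inj inj)|/perm_map].
rewrite -map_perm /abs_seq -!map_comp; congr (perm_eq _ _); apply: eq_map => i /=.
  by rewrite flat_abs.
by rewrite ffunE absz_nat -addnA; case: (_ \in _); rewrite ?addn1.
Qed.

Lemma base_gt0 i : gt \notin J -> 0 < base_vec J i.
Proof. by move=> tJ; rewrite ffunE tJ addn1. Qed.

Lemma prod_base0 : gt \in J -> \prod_j base_vec J j = 0.
Proof.
by move=> tJ; apply/eqP/prodf_eq0; exists pos1; rewrite // ffunE bars_before0 tJ.
Qed.

Lemma orbit_zero v : gt \in J -> in_orbit (base_vec J) v -> exists i, v i = 0.
Proof.
move=> tJ /andP[/perm_mem/(_ 0%N)]; rewrite (_ : 0%N \in abs_seq (base_vec J)).
  by move=> /mapP[i _ /esym/eqP]; rewrite absz_eq0 => /eqP; exists i.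
apply/mapP; exists pos1; first by rewrite mem_enum.
by rewrite ffunE bars_before0 tJ.
Qed.

Lemma flat_noJ a : gt \notin J -> flat a = a.
Proof. by move=> /negPf tJ; apply/ffunP => i; rewrite ffunE tJ. Qed.

Lemma unflat_noJ v : gt \notin J -> unflat v = v.
Proof. by move=> /negPf tJ; apply/ffunP => i; rewrite ffunE tJ. Qed.

(** Without zero entries the two products have the same nonzero absolute value, and that of
    [base_vec] is positive. *)
Lemma parity_noJ v : gt \notin J -> perm_eq (abs_seq v) (abs_seq (base_vec J)) ->
  (\prod_j v j == \prod_j base_vec J j) = ~~ odd #|[set j | v j < 0]|.
Proof.
move=> tJ pv; have absP (u : vec) : \prod_j `|u j| = (\prod_(m <- abs_seq u) m)%N%:Z.
  by rewrite /abs_seq big_map big_enum /=; elim/big_ind2: _ => // x x' y y' -> ->.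
have bP : \prod_j `|base_vec J j| = \prod_j base_vec J j.
  by apply: eq_bigr => j _; rewrite gtr0_norm ?base_gt0.
have b0 : 0 < \prod_j base_vec J j by apply: prodr_gt0 => j _; apply: base_gt0.
rewrite prod_sign absP (perm_big _ pv) /= -absP bP -signr_odd.
move: (\prod_j base_vec J j) b0 {bP} => B B0.
by case: odd => /=; rewrite ?expr0 ?expr1 ?mulN1r ?mul1r; lia.
Qed.

Lemma first_zero_exists v : (exists i, v i = 0) -> exists i, first_zero v i.
Proof.
move=> [i /eqP vi]; exists [arg min_(k < i | v k == 0) k].
case: arg_minnP => // k vk kmin; rewrite /first_zero vk /=.
by apply/forallP => j; apply/implyP => jk; apply: contraTN jk => /kmin; rewrite -leqNgt.
Qed.

Lemma first_zero_uniq v i j : first_zero v i -> first_zero v j -> i = j.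
Proof.
move=> /andP[vi /forallP hi] /andP[vj /forallP hj]; apply: val_inj => /=.
have := hi j; have := hj i; rewrite vi vj /= !implybF -!leqNgt => h h'.
by apply/eqP; rewrite eqn_leq h h'.
Qed.

Lemma unflat_shape v : in_orbit (base_vec J) v -> shape (unflat v).
Proof.
move=> ov.
have u0 i : unflat v i != 0.
  rewrite ffunE; case: (boolP (gt \in J)) => tJ; last first.
    have /andP[pv _] := ov; have : `|v i|%N \in abs_seq v.
      by apply: map_f; rewrite mem_enum.
    rewrite (perm_mem pv) => /mapP[j _]; have := base_gt0 j tJ.
    by move: (v i) (base_vec J j) => x y; lia.
  case: (eqVneq (v i) 0) => [_|vi]; first by case: (_ && _).
  by move: (v i) vi => x x0; case: (sgz_spec x) => -[hx ->]; lia.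
have [range cont] := proj2 (shape_abs (unflat v)) (etrans (esym (orbit_abs u0))
  (etrans (congr1 (fun u => perm_eq (abs_seq u) _) (unflatK v)) (proj1 (andP ov)))).
split=> //.
  have [tJ|tJ] := boolP (gt \in J); last first.
    by case/andP: ov => pv; rewrite unflat_noJ // parity_noJ.
  set N := [set j | v j < 0].
  have [z fz] := first_zero_exists (orbit_zero tJ ov).
  (* The first zero becomes negative exactly when the number of negative entries of [v] is odd,
     which makes the total even. *)
  have neg i : (unflat v i < 0) = (i \in N) || ((i == z) && odd #|N|).
    rewrite ffunE tJ inE; case: (eqVneq (v i) 0) => [vi|vi].
      rewrite vi ltxx /=; have [->|iz] := eqVneq i z.
        by rewrite fz /=; case: odd.
      rewrite (_ : first_zero v i = false) //.
      by apply: contraNF iz => /first_zero_uniq/(_ fz)->.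
    have -> : (i == z) = false.
      by apply: contraNF vi => /eqP->; case/andP: fz.
    rewrite orbF; move: (v i) vi => x x0.
    by case: (sgz_spec x) => -[hx ->]; lia.
  have zN : z \notin N by rewrite inE; case/andP: fz => /eqP->; rewrite ltxx.
  have [oN|oN] := boolP (odd #|N|).
    rewrite (_ : [set i | _] = z |: N); first by rewrite cardsU1 zN /= negbK.
    by apply/setP => i; rewrite !inE neg oN andbT orbC inE.
  rewrite (_ : [set i | _] = N) //.
  by apply/setP => i; rewrite !inE neg (negPf oN) andbF orbF inE.
move=> tJ; have m1 i : unflat v i = -1 -> first_zero v i.
  rewrite ffunE tJ; case: (eqVneq (v i) 0) => [vi|vi].
    by case: (boolP (first_zero v i)).
  by move: (v i) vi => x x0; case: (sgz_spec x) => -[hx ->]; lia.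
split.
  apply/card_le1_eqP => i j; rewrite !inE => /eqP/m1 fi /eqP/m1 fj.
  exact: first_zero_uniq fj fi.
move=> i /m1/andP[_ /forallP fi] j ji; rewrite ffunE tJ.
have /implyP/(_ ji)/negPf vj := fi j; rewrite vj.
move/negbT: vj; move: (v j) => x x0; case: (sgz_spec x) => -[hx ->]; lia.
Qed.

Lemma flat_orbit a : shape a -> in_orbit (base_vec J) (flat a).
Proof.
move=> [range cont even normal].
have a0 i : a i != 0 by have /andP[+ _] := range i; rewrite lt0n absz_eq0.
have pe : perm_eq (abs_seq (flat a)) (abs_seq (base_vec J)).
  by rewrite orbit_abs //; apply/shape_abs.
apply/andP; split=> //; have [tJ|tJ] := boolP (gt \in J); last first.
  by rewrite parity_noJ // flat_noJ.
rewrite prod_base0 //; have : 0%N \in abs_seq (flat a).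
  rewrite (perm_mem pe); apply/mapP; exists pos1; first by rewrite mem_enum.
  by rewrite ffunE bars_before0 tJ.
case/mapP => i _ /esym/eqP; rewrite absz_eq0 => fi.
by apply/prodf_eq0; exists i.
Qed.

Lemma flatK a : shape a -> unflat (flat a) = a.
Proof.
move=> [range cont even normal].
have a0 i : a i != 0 by have /andP[+ _] := range i; rewrite lt0n absz_eq0.
have [tJ|tJ] := boolP (gt \in J); last by rewrite unflat_noJ // flat_noJ.
have [one first] := normal tJ.
set M := [set i | a i == -1] in one.
(* The negative entries of [a] are those of [flat a] together with the entries -1 counted by [M].
   Their total is even and [M] has at most one element. *)
have oddM : odd #|[set j | flat a j < 0]| = (#|M| == 1%N).
  have : ~~ odd (#|[set j | flat a j < 0]| + #|M|).
    rewrite -cardsUI (_ : _ :&: _ = finset.set0) ?cards0 ?addn0.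
      rewrite (_ : _ :|: _ = [set i | a i < 0]) //; apply/setP => i.
      rewrite !inE flatE tJ; move: (a i) (a0 i) => x x0.
      by case: (sgz_spec x) => -[hx ->]; lia.
    apply/setP => i; rewrite !inE flatE tJ; move: (a i) => x.
    by case: (sgz_spec x) => -[hx ->]; lia.
  by rewrite oddD; case: #|M| one => [|[|]] //= _; case: odd.
apply/ffunP => i; rewrite ffunE tJ flat_eq0 // (negPf (a0 i)) /=.
case: ifP => [ai|ai]; last first.
  rewrite flatE tJ; move: (a i) (a0 i) ai => x x0 x1.
  case: (sgz_spec x) => -[hx ->]; first by lia.
    by case: (sgz_spec (x - 1%Z)) => -[hx' ->]; lia.
  by case: (sgz_spec (x - - 1%Z)) => -[hx' ->]; lia.
(* An earlier zero of [flat a] would come from an entry 1, against the normal form, or from a second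
   entry -1. *)
have fz k : a k = -1 -> first_zero (flat a) k.
  move=> ak; rewrite /first_zero flat_eq0 // ak eqxx orbT /=.
  apply/forallP => j; apply/implyP => jk; rewrite flat_eq0 // (negPf (a0 j)) /=.
  rewrite negb_or; apply/andP; split; first by apply/eqP; apply: first jk.
  apply/eqP => aj; have : [set j; k] \subset M.
    by apply/fintype.subsetP => l; rewrite !inE => /orP[] /eqP->; rewrite ?aj ?ak.
  move/subset_leq_card; rewrite cards2 -val_eqE /= (ltn_eqF jk) => h.
  by have := leq_trans h one.
rewrite oddM; case/orP: ai => /eqP ai; rewrite ai; last first.
  rewrite (fz i ai) (_ : #|M| = 1%N) //; apply/eqP; rewrite eqn_leq one.
  by apply/card_gt0P; exists i; rewrite inE ai.
case: (boolP (first_zero _ i)) => //= fi; case: eqP => // M1.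
have /card_gt0P[k] : (0 < #|M|)%N by rewrite M1.
rewrite inE => /eqP ak; have := first_zero_uniq fi (fz k ak) => ik.
by move: ak; rewrite -ik ai.
Qed.

End Normal.

(** * Statistics of sequences as signs of pairings *)

Section Statistics.
Variables (n : nat) (J : {set dgen n}).
Local Notation vec := {ffun 'I_n.+2 -> int}.
Implicit Types (a v : vec).

(** One coordinate of [flat], which reduces the conditions on two entries to linear arithmetic. *)
Definition flat1 (b : bool) (x : int) : int := if b then x - sgz x else x.

Lemma flat1P (b : bool) x : x != 0 ->
  if b then 0 < x /\ flat1 b x = x - 1%Z \/ x < 0 /\ flat1 b x = x + 1%Z
  else flat1 b x = x.
Proof.
rewrite /flat1; case: b => x0 //.
by case: (sgz_spec x) => -[hx ->]; [lia|left|right].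
Qed.

Lemma flat1_s b x y : x != 0 -> y != 0 ->
  (y <= x) || [&& b, x == -1 & y == 1] = (flat1 b y - flat1 b x <= 0).
Proof.
move=> x0 y0; have := flat1P b x0; have := flat1P b y0.
move: (flat1 b x) (flat1 b y) => u v.
by case: b => /= *; lia.
Qed.

(** The excluded pair [(1, -1)] flattens to two zeros without being weakly increasing. *)
Lemma flat1_s_eq b x y : x != 0 -> y != 0 -> ~~ [&& b, x == 1 & y == -1] ->
  flat1 b y - flat1 b x <= 0 -> (x <= y) = (flat1 b y - flat1 b x == 0).
Proof.
move=> x0 y0; have := flat1P b x0; have := flat1P b y0.
move: (flat1 b x) (flat1 b y) => u v.
by case: b => /= *; lia.
Qed.

Lemma flat1_t b x y : x != 0 -> y != 0 ->
  [/\ (`|y| < `|x|)%N -> x < 0, (`|x| < `|y|)%N -> y < 0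
    & `|x|%N = `|y|%N -> [|| x < 0, y < 0 | [&& x == 1, y == 1 & b]]] <->
  flat1 b x + flat1 b y <= 0.
Proof.
move=> x0 y0; have := flat1P b x0; have := flat1P b y0.
move: (flat1 b x) (flat1 b y) => u v.
by case: b => /= h h'; (split=> [[]|?]; [|split]; lia).
Qed.

(** The excluded pair [(-1, -1)] flattens to two zeros, but its entries are not opposite. *)
Lemma flat1_t_eq b x y : x != 0 -> y != 0 -> ~~ [&& b, x == -1 & y == -1] ->
  flat1 b x + flat1 b y <= 0 ->
  ((x == - y) || ((x == 1) && (y == 1))) = (flat1 b x + flat1 b y == 0) /\
  (((x == y) && (y < 0)) || (`|x|%N != `|y|%N)) = (flat1 b x + flat1 b y != 0).
Proof.
move=> x0 y0; have := flat1P b x0; have := flat1P b y0.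
move: (flat1 b x) (flat1 b y) => u v.
by case: b => /= *; split; lia.
Qed.

Lemma flat_flat1 a i : flat J a i = flat1 (gt \in J) (a i).
Proof. by rewrite ffunE. Qed.

(** The conditions on [K] discard the orbit points at which some generator of [K] has positive
    pairing, hence diagonal coefficient 0. *)
Lemma admissibleE (K : {set dgen n}) a : admissible J K a <->
  shape J a /\ forall s, s \in K -> dotr s (flat J a) <= 0.
Proof.
have key (a0 : forall i, a i != 0) : (forall s, s \in K -> dotr s (flat J a) <= 0) <->
    (forall i : 'I_n.+1, gs i \in K -> a (pos_r i) <= a (pos_l i) \/
      [/\ gt \in J, a (pos_l i) = -1 & a (pos_r i) = 1]) /\
    (gt \in K -> [/\ (`|a pos2| < `|a pos1|)%N -> a pos1 < 0,
        (`|a pos1| < `|a pos2|)%N -> a pos2 < 0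
      & `|a pos1|%N = `|a pos2|%N ->
        [\/ a pos1 < 0, a pos2 < 0 | [/\ a pos1 = 1, a pos2 = 1 & gt \in J]]]).
  have tP : [/\ (`|a pos2| < `|a pos1|)%N -> a pos1 < 0,
        (`|a pos1| < `|a pos2|)%N -> a pos2 < 0
      & `|a pos1|%N = `|a pos2|%N ->
        [\/ a pos1 < 0, a pos2 < 0 | [/\ a pos1 = 1, a pos2 = 1 & gt \in J]]] <->
      dotr None (flat J a) <= 0.
    rewrite /= !flat_flat1 -flat1_t //; split=> -[h1 h2 h3]; split=> // /h3.
      by case=> [->|->|[-> -> ->]]; rewrite ?orbT.
    by case/or3P => [->|->|/and3P[/eqP-> /eqP-> ->]]; [constructor 1|constructor 2|constructor 3].
  have sP i : (a (pos_r i) <= a (pos_l i) \/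
      [/\ gt \in J, a (pos_l i) = -1 & a (pos_r i) = 1]) <-> dotr (Some i) (flat J a) <= 0.
    rewrite /= !flat_flat1 -flat1_s //; split.
      by case=> [->//|[-> -> ->]]; rewrite orbT.
    by case/orP => [->|/and3P[-> /eqP-> /eqP->]]; [left|right].
  split=> [h|[hs ht] [i|] sK]; last by apply/tP/ht.
    by split=> [i iK|tK]; [apply/sP/h|apply/tP/h].
  by apply/sP/hs.
split=> [[r c e m hs ht]|[[r c e m] h]].
  split; first by split.
  by apply/key => // i; have /andP[+ _] := r i; rewrite lt0n absz_eq0.
have [|hs ht] := proj1 (key _) h; last by split.
by move=> i; have /andP[+ _] := r i; rewrite lt0n absz_eq0.
Qed.

Lemma big_dgen (A : comNzRingType) (K : {set dgen n}) (F : dgen n -> A) :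
  \prod_(s in K) F s = (if gt \in K then F gt else 1) * \prod_(i | gs i \in K) F (gs i).
Proof.
rewrite [LHS]big_mkcond (bigD1 gt) //=; congr (_ * _).
rewrite [RHS]big_mkcond /= (reindex_omap gs id) /=; last by case.
by apply: eq_bigl => i; rewrite eqxx.
Qed.

(** The statistics e and g count the zero pairings, each with factor [c]; d and f count the negative
    ones, each with factor [q - 1]. *)
Lemma weight_prod (A : comNzRingType) (q c : A) (K : {set dgen n}) a : shape J a ->
  (forall s, s \in K -> dotr s (flat J a) <= 0) ->
  c ^+ (stat_e K a + stat_g K a) * (q - 1) ^+ (stat_d K a + stat_f K a) =
  \prod_(s in K) (if dotr s (flat J a) == 0 then c
                  else if 0 < dotr s (flat J a) then 0 else q - 1).
Proof.
move=> [r _ _ normal] h.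
have a0 i : a i != 0 by have /andP[+ _] := r i; rewrite lt0n absz_eq0.
rewrite (eq_bigr (fun s => if dotr s (flat J a) == 0 then c else q - 1)); last first.
  by move=> s /h hs; rewrite (ltNge 0) hs.
(* The normal form rules out the ambiguous pairs: no 1 precedes a -1, and -1 occurs at most once. *)
have norm_s i : ~~ [&& gt \in J, a (pos_l i) == 1 & a (pos_r i) == -1].
  apply/and3P => -[tJ /eqP al /eqP ar].
  have [_ /(_ _ ar (pos_l i))] := normal tJ.
  by rewrite !posE => /(_ (leqnn _)).
have norm_t : ~~ [&& gt \in J, a pos1 == -1 & a pos2 == -1].
  apply/and3P => -[tJ a1 a2].
  have [/card_le1_eqP/(_ pos1 pos2)] := normal tJ.
  by rewrite !inE => /(_ a1 a2).
rewrite big_dgen (bigID (fun i => dotr (gs i) (flat J a) == 0)) /=.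
have sE i : gs i \in K -> (dotr (gs i) (flat J a) == 0) = (a (pos_l i) <= a (pos_r i)).
  by move=> /h; rewrite /= !flat_flat1 => hi; rewrite -flat1_s_eq.
rewrite (eq_bigr (fun=> c)); last by move=> i /andP[_ ->].
rewrite [in X in _ * (_ * X)](eq_bigr (fun=> q - 1)); last by move=> i /andP[_ /negPf->].
rewrite !prodr_const.
have eE : stat_e K a = #|[pred i | (gs i \in K) && (dotr (gs i) (flat J a) == 0)]|.
  apply: eq_card => i; rewrite !inE; case: (boolP (gs i \in K)) => //= iK.
  by rewrite -sE.
have dE : stat_d K a = #|[pred i | (gs i \in K) && (dotr (gs i) (flat J a) != 0)]|.
  apply: eq_card => i; rewrite !inE; case: (boolP (gs i \in K)) => //= iK.
  by rewrite ltNge -sE.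
rewrite -eE -dE /stat_f /stat_g.
case: (boolP (gt \in K)) => [tK|_]; last by rewrite !addn0 mul1r.
have := h _ tK; rewrite /= !flat_flat1 => /(flat1_t_eq (a0 _) (a0 _) norm_t)[-> ->].
by case: eqP => _ /=; rewrite ?addn0 ?addn1 exprS; ring.
Qed.

(** [unflat] is a bijection from the points with no positive pairing in [K] to the admissible
    sequences; every other point has a factor 0. *)
Lemma sum_orbit (A : comNzRingType) (q c : A) (K : {set dgen n}) :
  \sum_(x : orbit_rs (base_vec J)) \prod_(s in K) diag_coef q c s x =
  \sum_(a \in [set a | admissible J K a]%classic)
    c ^+ (stat_e K a + stat_g K a) * (q - 1) ^+ (stat_d K a + stat_f K a).
Proof.
pose X := orbit_rs (base_vec J); pose h (x : X) := unflat J (orbit_val x).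
pose P (x : X) := [forall s in K, dotr s (orbit_val x) <= 0].
have hK (x : X) : flat J (h x) = orbit_val x by rewrite /h unflatK.
have shapeh (x : X) : shape J (h x) by apply: unflat_shape; apply: orbit_valP.
rewrite (reindex_fsbig h [set x : X | P x]%classic); last first.
  split.
  - move=> x /forall_inP Px; apply/admissibleE; split=> // s sK.
    by rewrite hK; apply: Px.
  - by move=> x y _ _ /(congr1 (flat J)); rewrite !hK => /orbit_val_inj.
  - move=> a /admissibleE[sa da]; exists (orbit_mk (flat_orbit sa)).
      by apply/forall_inP => s /da.
    by rewrite /h /= flatK.
transitivity (\sum_(x <- [seq x <- index_enum X | P x]) \prod_(s in K) diag_coef q c s x).
  rewrite big_filter [RHS]big_mkcond /=; apply: eq_bigr => x _.
  case: ifP => // /negbT; rewrite negb_forall_in => /existsP[s /andP[sK]].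
  rewrite -ltNge => xs; rewrite (bigD1 s) //= /diag_coef /=.
  by rewrite xs gt_eqF // mul0r.
have enumP : [set` [seq x <- index_enum X | P x]]%classic = [set x : X | P x]%classic.
  by apply/seteqP; split=> x /=; rewrite mem_filter mem_index_enum andbT.
rewrite [LHS]fsbig_seq ?filter_uniq ?index_enum_uniq // enumP.
apply: eq_fsbigr => x; rewrite inE => /forall_inP Px.
by rewrite (weight_prod q c (shapeh x)) ?hK.
Qed.

End Statistics.

Theorem theorem2p6 (R : realType) (n : nat) (J K : {set dgen n})
    (hJ : ~ (gs ord0 \notin J /\ gt \in J))
    (w : {perm signed n.+2}) (hwD : w \in typeD n.+2)
    (hwK : parabolic_of_type K w)
    (r : seq (dgen n)) (hr : reduced_expr w r) :
  let q := hecke_q R in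
  let Tw := hecke_Tword q r in
  eta J Tw =
    \sum_(a \in [set a | admissible J K a]%classic)
      q ^+ (stat_e K a + stat_g K a) * (q - 1) ^+ (stat_d K a + stat_f K a) /\
  epsilon J Tw =
    \sum_(a \in [set a | admissible J K a]%classic)
      (-1) ^+ (stat_e K a + stat_g K a) * (q - 1) ^+ (stat_d K a + stat_f K a).
Proof.
move=> q Tw; have rK := reduced_perm_enum hwK hr.
split; rewrite -sum_orbit.
  (* The trivial and sign representations are the cases [c = q] and [c = -1]. *)
  exact: (char_orbit hJ (q_root q) rK).
exact: (char_orbit hJ (m1_root q) rK).
Qed.
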